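(* Let $n\ge 2$ and $m\ge 1$ be integers, $p\in[1,n)$, $Q\in\mathcal{K}_o^{1,m}$, and let $K\subset M_{n,1}(\mathbb{R})=\mathbb{R}^n$ be compact. Then: i) (Monotonicity) $C_{p,Q}(K)\le C_{p,Q}(L)$ whenever $L\subset\mathbb{R}^n$ is compact and $K\subset L$. ii) (Homogeneity) $C_{p,bQ}(aK)=b^p a^{n-p}C_{p,Q}(K)$ for all $a,b>0$, where $aK=\{ax:x\in K\}$ and $bQ=\{bx: x\in Q\}$. iii) (Finiteness) $C_{p,Q}(K)<\infty$.
   Context: $M_{n,m}(\mathbb{R})$ is the space of real $n\times m$ matrices with inner product $\mathrm{tr}(x^{\mathrm T}y)$ and the induced norm; $S^{nm-1}$ is its unit sphere and $du$ the spherical (Hausdorff) measure on it. $M_{n,1}(\mathbb{R})$ and $M_{1,m}(\mathbb{R})$ are identified with $\mathbb{R}^n$ and $\mathbb{R}^m$. $\mathcal{K}_o^{1,m}$ is the set of compact convex sets with nonempty interior in $M_{1,m}(\mathbb{R})$ containing the origin $o$. The support function is $h_Q(x)=\max\{x\cdot y:y\in Q\}$. For a smooth compactly supported $f:\mathbb{R}^n\to\mathbb{R}$ (i.e. $f\in C_c^\infty$) and $u\in S^{nm-1}$, put $\nabla_u f(x)=(\nabla f(x))^{\mathrm T}u\in M_{1,m}(\mathbb{R})$ (matrix product) and $\|h_Q(\nabla_u f)\|_p=\big(\int_{\mathbb{R}^n}h_Q(\nabla_u f(x))^p\,dx\big)^{1/p}$. For compact $K\subset\mathbb{R}^n$, the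 $m$th order $p$-affine capacity is $$C_{p,Q}(K)=\inf\Big\{\Big(\int_{S^{nm-1}}\|h_Q(\nabla_u f)\|_p^{-nm}\,du\Big)^{-\frac{p}{nm}}: f\in C_c^\infty,\ f\ge 1\text{ on }K\Big\},$$ with the conventions $0^{-a}=\infty$, $\infty^{-a}=0$ for $a>0$. *)

(* Defs.v *)
From HB Require Import structures.
From mathcomp Require Export all_boot all_order all_algebra.
From mathcomp Require Export all_classical all_reals all_analysis.

Set Implicit Arguments.
Unset Strict Implicit.
Unset Printing Implicit Defensive.

Import Order.TTheory GRing.Theory Num.Theory numFieldNormedType.Exports.

Local Open Scope classical_set_scope.
Local Open Scope ring_scope.

Section tuple_cons.
Context d (T : measurableType d).

Definition tuple_cons n (x : T * n.-tuple T) : n.+1.-tuple T :=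
  [tuple of x.1 :: x.2].

Lemma measurable_tuple_cons n : measurable_fun setT (@tuple_cons n).
Proof. exact: measurable_cons. Qed.

HB.instance Definition _ n := isMeasurableFun.Build _ _ _ _ (@tuple_cons n)
  (@measurable_tuple_cons n).

Definition tuple_uncons n (t : n.+1.-tuple T) : T * n.-tuple T :=
  (thead t, [tuple of behead t]).

Lemma tuple_consK n : cancel (@tuple_cons n) (@tuple_uncons n).
Proof.
by move=> [x t]; rewrite /tuple_uncons /tuple_cons/=; congr pair; exact/val_inj.
Qed.

Lemma measurable_tuple_uncons n : measurable_fun setT (@tuple_uncons n).
Proof.
apply: measurable_fun_pair; first exact: measurable_tnth.
exact: measurable_behead.
Qed.

End tuple_cons.

Section tuple_measure.
Context d (T : measurableType d) (R : realType).
Variable m : {sigma_finite_measure set T -> \bar R}.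
Local Open Scope ereal_scope.

Section step.
Variables (n : nat) (mu : {sigma_finite_measure set (n.-tuple T) -> \bar R}).

Definition tuple_measure_step : set (n.+1.-tuple T) -> \bar R :=
  pushforward (m \x mu) (@tuple_cons _ T n).

Let step0 : tuple_measure_step set0 = 0.
Proof. exact: measure0. Qed.

Let step_ge0 A : 0 <= tuple_measure_step A.
Proof. exact: measure_ge0. Qed.

Let step_sigma_additive : semi_sigma_additive tuple_measure_step.
Proof. exact: measure_semi_sigma_additive. Qed.

HB.instance Definition _ := isMeasure.Build _ _ _ tuple_measure_step
  step0 step_ge0 step_sigma_additive.

Let step_sigma_finite : sigma_finite setT tuple_measure_step.
Proof.
have /sigma_finiteP[F [TF ndF Foo]] := sigma_finiteT m.
have /sigma_finiteP[G [TG ndG Goo]] := sigma_finiteT mu.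
exists (fun k => @tuple_uncons _ T n @^-1` (F k `*` G k)).
  rewrite -preimage_bigcup (_ : \bigcup_k _ = setT) ?preimage_setT//.
  rewrite -subTset -setXTT TF TG => -[x y] /= [[i _ Fix] [j _ Gjy]].
  exists (maxn i j) => //; split.
    by move: x Fix; exact/subsetPset/ndF/leq_maxl.
  by move: y Gjy; exact/subsetPset/ndG/leq_maxr.
move=> k; have [? ?] := Foo k; have [? ?] := Goo k.
have mFG : measurable (F k `*` G k) by exact: measurableX.
split; first by rewrite -[X in measurable X]setTI; exact: measurable_tuple_uncons.
rewrite /tuple_measure_step /pushforward -comp_preimage.
rewrite (_ : _ \o _ = id) ?preimage_id; last exact/funext/tuple_consK.
by rewrite product_measure1E// lte_mul_pinfty// ge0_fin_numE.
Qed.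

HB.instance Definition _ := Measure_isSigmaFinite.Build _ _ _
  tuple_measure_step step_sigma_finite.

End step.

Fixpoint tuple_measure (n : nat) :
    {sigma_finite_measure set (n.-tuple T) -> \bar R} :=
  if n is k.+1 then tuple_measure_step (tuple_measure k)
  else \d_([tuple] : 0.-tuple T).

End tuple_measure.

Definition lebesgue_tuple (R : realType) (n : nat) :
    {sigma_finite_measure set (n.-tuple (measurableTypeR R)) -> \bar R} :=
  tuple_measure (@lebesgue_measure R) n.

Definition unit_ball_volume (R : realType) (k : nat) : \bar R :=
  lebesgue_tuple R k
    [set t : k.-tuple (measurableTypeR R) |
      \sum_(i < k) (tnth t i : R) ^+ 2 <= 1].

Section frobenius.
Context {R : realType} {n m : nat}.
Implicit Types x y : 'M[R]_(n, m).

Definition mxdot x y : R := \tr (x^T *m y).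

(* the library norm `|x| of a matrix is the sup norm *)
Definition mxnorm2 x : R := Num.sqrt (mxdot x x).

Definition mxsphere : set 'M[R]_(n, m) := [set u | mxnorm2 u = 1].

End frobenius.

Section hausdorff.
Context {R : realType} {n m : nat}.
Variable k : nat.
Local Notation T := 'M[R]_(n, m).
Local Open Scope ereal_scope.

(* -oo on the empty set, which hausdorff_gauge therefore treats separately *)
Definition mxdiam (E : set T) : \bar R :=
  ereal_sup [set (mxnorm2 (z.1 - z.2))%:E | z in E `*` E].

(* The factor unit_ball_volume R k * 2^-k makes the k-dimensional Hausdorff
   measure agree with the k-dimensional surface area. *)
Definition hausdorff_gauge (E : set T) : \bar R :=
  if E == set0 then 0
  else unit_ball_volume R k * ((2^-1)%:E * mxdiam E) ^+ k.

Definition hausdorff_cover (delta : R) (A : set T) : set (set T)^nat :=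
  [set E | (forall i, mxdiam (E i) <= delta%:E) /\ A `<=` \bigcup_i E i].

Definition hausdorff_pre (delta : R) (A : set T) : \bar R :=
  ereal_inf [set \sum_(i <oo) hausdorff_gauge (E i)
            | E in hausdorff_cover delta A].

Definition hausdorff (A : set T) : \bar R :=
  ereal_sup [set hausdorff_pre delta A | delta in [set delta : R | (0 < delta)%R]].

Lemma hausdorff_gauge_ge0 E : 0 <= hausdorff_gauge E.
Proof.
rewrite /hausdorff_gauge; case: ifPn => // /set0P[x Ex].
rewrite mule_ge0 ?measure_ge0// expe_ge0// mule_ge0 ?lee_fin ?invr_ge0//.
apply: (@le_trans _ _ (mxnorm2 (x - x))%:E); first by rewrite lee_fin sqrtr_ge0.
by apply: ereal_sup_ubound; exists (x, x).
Qed.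

Lemma hausdorff_gauge0 : hausdorff_gauge set0 = 0.
Proof. by rewrite /hausdorff_gauge eqxx. Qed.

Lemma hausdorff_pre_ge0 delta A : 0 <= hausdorff_pre delta A.
Proof.
apply: le_ereal_inf_tmp => _ [E _ <-].
by apply: nneseries_ge0 => i _ _; exact: hausdorff_gauge_ge0.
Qed.

Lemma hausdorff_pre_sigma_subadditive delta :
  sigma_subadditive (hausdorff_pre delta).
Proof.
move=> A; have [[i ioo]|] := pselect (exists i, hausdorff_pre delta (A i) = +oo).
  rewrite (eseries_pinfty _ _ ioo) ?leey// => j _.
  by rewrite -ltNye (lt_le_trans _ (hausdorff_pre_ge0 _ _)).
rewrite -forallNE => Aoo.
suff add2e (e : {posnum R}) : hausdorff_pre delta (\bigcup_n A n) <=
    \sum_(i <oo) hausdorff_pre delta (A i) + e%:num%:E.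
  by apply/lee_addgt0Pr => _/posnumP[].
rewrite (le_trans _ (epsilon_trick _ _ _))//; last first.
  by move=> j; exact: hausdorff_pre_ge0.
pose P j (B : (set T)^nat) := hausdorff_cover delta (A j) B /\
  \sum_(i <oo) hausdorff_gauge (B i) <=
  hausdorff_pre delta (A j) + (e%:num / (2 ^ j.+1)%:R)%:E.
have [G PG] : {G : ((set T)^nat)^nat & forall j, P j (G j)}.
  apply: (@choice _ _ P) => j; rewrite /P /hausdorff_pre.
  set S := (X in ereal_inf X); move infS : (ereal_inf S) => iS.
  case: iS infS => [r Sr|Soo|Soo].
  - have en1 : (0 < e%:num / (2 ^ j.+1)%:R)%R by [].
    have /(lb_ereal_inf_adherent en1) : ereal_inf S \is a fin_num by rewrite Sr.
    move=> [x [B cB muBx] xS].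
    by exists B; split => //; rewrite muBx -Sr; exact/ltW.
  - by have := Aoo j; rewrite /hausdorff_pre Soo.
  - by have := hausdorff_pre_ge0 delta (A j); rewrite /hausdorff_pre Soo.
have gG_ge0 x : 0 <= (hausdorff_gauge \o uncurry G) x.
  exact: hausdorff_gauge_ge0.
apply: (@le_trans _ _ (\esum_(i in setT) (hausdorff_gauge \o uncurry G) i)).
  apply: ereal_inf_lbound => /=.
  have /card_esym/ppcard_eqP[f] := card_nat2.
  exists (uncurry G \o f).
    split => [i|]; first by rewrite /=; case: (f i) => a b; exact: (PG a).1.1.
    move=> t [i _ /((PG i).1.2)[j _ Gijt]].
    by exists (f^-1%FUN (i, j)) => //=; rewrite invK ?inE.
  rewrite -(esum_pred_image (hausdorff_gauge \o uncurry G) _ xpredT)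
    ?[fun=> _]set_true//.
  by rewrite image_eq.
rewrite (_ : esum _ _ = \sum_(i <oo) \sum_(j <oo) hausdorff_gauge (G i j));
  last first.
  pose J : nat -> set (nat * nat) := fun i => [set (i, j) | j in setT].
  rewrite (_ : setT = \bigcup_k J k); last first.
    by rewrite predeqE => -[a b]; split => // _; exists a => //; exists b.
  rewrite esum_bigcupT /=; last 2 first.
    - apply/trivIsetP => i j _ _ ij.
      rewrite predeqE => -[a b] /=; split => //= -[] [_] _ [<-{a} _].
      by move=> [b' _] [] /esym/eqP; rewrite (negbTE ij).
    - by move=> /= [a b]; exact: hausdorff_gauge_ge0.
  rewrite -(image_id [set: nat]) -fun_true esum_pred_image//; last first.
    by move=> a _; apply: esum_ge0 => z _; exact: hausdorff_gauge_ge0.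
  apply: eq_eseriesr => /= j _.
  rewrite -(esum_pred_image (hausdorff_gauge \o uncurry G) (pair j) predT)//=;
    last 2 first.
    - by move=> a _; exact: hausdorff_gauge_ge0.
    - by move=> ? ? _ _; exact: (@can_inj _ _ _ snd).
  by congr esum; rewrite predeqE => -[a b]; split; move=> [i _ <-]; exists i.
apply: lee_lim.
- apply: is_cvg_nneseries => a *.
  by apply: nneseries_ge0 => b *; exact: (gG_ge0 (a, b)).
- by apply: is_cvg_nneseries => a *; apply: adde_ge0 => //; exact: hausdorff_pre_ge0.
- by near=> a; apply: lee_sum => i _; exact: (PG i).2.
Unshelve. all: by end_near. Qed.

Let hausdorff0 : hausdorff set0 = 0.
Proof.
apply/eqP; rewrite eq_le; apply/andP; split.
  apply: ge_ereal_sup => _ [delta delta0 <-].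
  apply: ereal_inf_lbound; exists (fun=> set0).
    split=> // i; apply: ge_ereal_sup => _ [z [] //].
  by rewrite eseries0// => i _ _; exact: hausdorff_gauge0.
apply: (le_trans (hausdorff_pre_ge0 1 set0)).
by apply: ereal_sup_ubound; exists 1%R => //=.
Qed.

Let hausdorff_ge0 A : 0 <= hausdorff A.
Proof.
apply: (le_trans (hausdorff_pre_ge0 1 A)).
by apply: ereal_sup_ubound; exists 1%R => //=.
Qed.

Let le_hausdorff : {homo hausdorff : A B / A `<=` B >-> A <= B}.
Proof.
move=> A B AB; apply: ge_ereal_sup => _ [delta delta0 <-].
apply: (@le_trans _ _ (hausdorff_pre delta B)).
  apply: le_ereal_inf_tmp => _ [E [dE BE] <-].
  by apply: ereal_inf_lbound; exists E => //; split => //; exact: subset_trans BE.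
by apply: ereal_sup_ubound; exists delta.
Qed.

Let hausdorff_sigma_subadditive : sigma_subadditive hausdorff.
Proof.
move=> F; apply: ge_ereal_sup => _ [delta delta0 <-].
apply: (le_trans (hausdorff_pre_sigma_subadditive _ _)).
apply: lee_nneseries => [i _ _|i _]; first exact: hausdorff_pre_ge0.
by apply: ereal_sup_ubound; exists delta.
Qed.

HB.instance Definition _ := isOuterMeasure.Build R T hausdorff
  hausdorff0 hausdorff_ge0 le_hausdorff hausdorff_sigma_subadditive.

Definition hausdorff_outer : {outer_measure set T -> \bar R} := hausdorff.

(* Restriction of the outer measure to its Caratheodory sigma-algebra, which
   contains the Borel sets. *)
Definition hausdorff_measure :
    {measure set (caratheodory_type hausdorff_outer) -> \bar R} :=
  (hausdorff_outer : set (caratheodory_type hausdorff_outer) -> \bar R).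

End hausdorff.
Arguments hausdorff_measure {R} n m k.

Section smooth.
Context {R : realType} {n : nat}.
Implicit Types f : 'cV[R]_n -> R.

Definition partial (i : 'I_n) f : 'cV[R]_n -> R := 'D_(delta_mx i 0) f.

Definition gradient f (x : 'cV[R]_n) : 'cV[R]_n := \col_i partial i f x.

Fixpoint Ck (k : nat) f : Prop :=
  continuous f /\
  if k is k'.+1 then
    forall i, (forall x, derivable f x (delta_mx i 0)) /\ Ck k' (partial i f)
  else True.

Definition Cc_infty : set ('cV[R]_n -> R) :=
  [set f | (forall k, Ck k f) /\ compact (closure [set x | f x != 0])].

End smooth.

(* a maximum for the nonempty compact sets Q considered here *)
Definition support_function {R : realType} {m : nat} (Q : set 'rV[R]_m)
  (x : 'rV[R]_m) : R := sup [set mxdot x y | y in Q].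

Definition convex_body_o {R : realType} {m : nat} (Q : set 'rV[R]_m) : Prop :=
  [/\ compact Q, convex_set (Q : set (convex_lmodType 'rV[R]_m)),
      interior Q !=set0 & Q 0].

(* x^(-a), with 0^(-a) = +oo and (+oo)^(-a) = 0 for a > 0; the library has
   0 `^ (- a) = 0 and +oo `^ (- a) = +oo instead *)
Definition poweRneg {R : realType} (x : \bar R) (a : R) : \bar R :=
  ((x `^ a)^-1)%E.

Section capacity.
Context {R : realType} {n m : nat}.
Variables (p : R) (Q : set 'rV[R]_m).

Definition mxgradient (u : 'M[R]_(n, m)) (f : 'cV[R]_n -> R) (x : 'cV[R]_n) :
  'rV[R]_m := (gradient f x)^T *m u.

(* R^n carries its Lebesgue measure as n.-tuple R and its topology as 'cV[R]_n,
   the tuple t being identified with the column \col_i tnth t i *)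
Definition pnorm_support (u : 'M[R]_(n, m)) (f : 'cV[R]_n -> R) : \bar R :=
  ((\int[lebesgue_tuple R n]_t
      ((support_function Q (mxgradient u f (\col_i tnth t i))) `^ p)%:E)
    `^ p^-1)%E.

Definition capacity_energy (f : 'cV[R]_n -> R) : \bar R :=
  poweRneg
    (\int[hausdorff_measure n m (n * m).-1]_(u in mxsphere)
       poweRneg (pnorm_support u f) (n * m)%:R)%E
    (p / (n * m)%:R).

Definition capacity (K : set 'cV[R]_n) : \bar R :=
  ereal_inf [set capacity_energy f
            | f in [set f | Cc_infty f /\ forall x, K x -> 1 <= f x]].

End capacity.

(* Main.v *)
(** The monotonicity and the homogeneity come from comparing and from dilating
    the admissible functions, f being replaced by f (a^-1 x).

    For the finiteness it is enough that one smooth bump function f >= 1 on K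
    has finite energy.  Its gradient is bounded with compact support, so
    ||h_Q (nabla_u f)||_p is bounded on the sphere, uniformly in u, and it
    remains to see that the sphere has positive Hausdorff measure of dimension
    nm - 1.  Dropping one coordinate maps the sphere onto the unit ball of
    R^(nm-1) without increasing distances, hence a cover of the sphere by sets
    of diameters d_i gives a cover of a cube by cubes of edges 2 d_i, whose
    volumes add up to at least the volume of the cube.  The sphere is
    Caratheodory measurable because the Hausdorff measure is additive on sets
    at positive distance. *)

From HB Require Import structures.
Require Import Defs.
From mathcomp Require Import all_boot all_order all_algebra.
From mathcomp Require Import all_classical all_reals all_analysis.
From mathcomp Require Import measurable_realfun ring lra zify.

Import Order.TTheory GRing.Theory Num.Theory numFieldNormedType.Exports.

Local Open Scope classical_set_scope.
Local Open Scope ring_scope.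

(** * Integrals of nonnegative functions *)

(* The integrands over the sphere and over R^n are not shown to be measurable:
   integrals of nonnegative functions being suprema of integrals of simple
   functions, monotonicity, scaling and change of variables hold without it. *)
Section nonmeasurable_integral.
Context d (T : measurableType d) (R : realType).
Variable mu : {measure set T -> \bar R}.
Implicit Types (f g : T -> \bar R) (D : set T).
Local Open Scope ereal_scope.
Import HBNNSimple.

Lemma ge0_integral_supE D f : (forall x, D x -> 0 <= f x) ->
  \int[mu]_(x in D) f x =
  ereal_sup [set sintegral mu h |
    h in [set h : {nnsfun T >-> R} | forall x, (h x)%:E <= (f \_ D) x]].
Proof. exact: ge0_integralE. Qed.

Lemma ge0_le_integral_any D f g : (forall x, D x -> 0 <= f x) ->
  (forall x, D x -> f x <= g x) ->
  \int[mu]_(x in D) f x <= \int[mu]_(x in D) g x.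
Proof.
move=> f0 fg.
have g0 x : D x -> 0 <= g x by move=> Dx; exact: le_trans (f0 _ Dx) (fg _ Dx).
rewrite !ge0_integral_supE//; apply: ereal_sup_le => _ [h hf <-].
exists h => // x; apply: le_trans (hf x) _.
by rewrite /patch; case: ifPn => // /[!inE] /fg.
Qed.

(** Upper bounds are tested on simple functions below [f]; these are measurable, so that the usual
    rules of integration apply to them. *)
Lemma ge0_integral_le_nnsfun f (c : \bar R) : (forall x, 0 <= f x) ->
  (forall h : {nnsfun T >-> R}, (forall x, (h x)%:E <= f x) ->
    \int[mu]_x (h x)%:E <= c) ->
  \int[mu]_x f x <= c.
Proof.
move=> f0 hc; rewrite ge0_integral_supE//; apply: ge_ereal_sup => _ [h hf <-].
by rewrite -integralT_nnsfun hc// => x; have := hf x; rewrite patch_setT.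
Qed.

(** Simple functions below [f] give the inequality from left to right in [leZ], for every positive
    factor. The converse is the same inequality for the factor [k^-1] and the function [k f]. *)
Lemma ge0_integralZl_any D f (k : R) : (0 < k)%R ->
  (forall x, D x -> 0 <= f x) ->
  \int[mu]_(x in D) (k%:E * f x) = k%:E * \int[mu]_(x in D) f x.
Proof.
have leZ (c : R) g : (0 < c)%R -> (forall x, 0 <= g x) ->
    c%:E * \int[mu]_x g x <= \int[mu]_x (c%:E * g x).
  move=> c0 g0; rewrite -lee_pdivlMl//; apply: ge0_integral_le_nnsfun => // h hg.
  rewrite lee_pdivlMl// -ge0_integralZl//; first last.
  - by rewrite lee_fin ltW.
  - by move=> x _; rewrite lee_fin.
  - exact/measurable_EFinP.
  apply: ge0_le_integral_any => x _; first by rewrite mule_ge0 ?lee_fin// ltW.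
  by rewrite lee_pmul2l.
move=> k0 f0; rewrite !(integral_mkcond D).
have g0 x : 0 <= (f \_ D) x by rewrite /patch; case: ifPn => // /[!inE] /f0.
rewrite (_ : _ \_ D = fun x => k%:E * (f \_ D) x); last first.
  by apply/funext => x; rewrite /patch; case: ifPn; rewrite ?mule0.
apply/eqP; rewrite eq_le leZ// andbT -lee_pdivrMl//.
apply: le_trans (leZ k^-1%R (fun x => k%:E * (f \_ D) x) _ _) _ => //.
- by rewrite invr_gt0.
- by move=> x; rewrite mule_ge0 ?lee_fin ?(ltW k0).
- apply: ge0_le_integral_any => x _; rewrite muleA -EFinM mulVf ?gt_eqF// mul1e//.
Qed.

End nonmeasurable_integral.

Section change_of_variables.
Context d1 d2 (X : measurableType d1) (Y : measurableType d2) (R : realType).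
Variables (mu : {measure set X -> \bar R}) (nu : {measure set Y -> \bar R}).
Local Open Scope ereal_scope.
Import HBNNSimple.

(** A simple [h <= f] yields the measurable function [h \o phi] below [f \o phi], and the
    pushforward of [mu] by [phi] is [c nu]. Only one inequality results, since a simple function
    below [f \o phi] need not factor through [phi]. *)
Lemma ge0_integral_comp_ge (phi : X -> Y) (c : R) (f : Y -> \bar R) :
  measurable_fun setT phi -> (0 < c)%R ->
  (forall A, measurable A -> mu (phi @^-1` A) = c%:E * nu A) ->
  (forall y, 0 <= f y) ->
  c%:E * \int[nu]_y f y <= \int[mu]_x f (phi x).
Proof.
move=> mphi c0 muphi f0.
rewrite -lee_pdivlMl//; apply: ge0_integral_le_nnsfun => // h hf.
have c0' : (0 <= c)%R by exact: ltW.
rewrite lee_pdivlMl//.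
pose mphi_mixin := isMeasurableFun.Build _ _ _ _ _ mphi.
pose mphi_pack : {mfun X >-> Y} := HB.pack phi mphi_mixin.
have mh : measurable_fun [set: Y] (fun y => (h y)%:E) by exact/measurable_EFinP.
rewrite -(@ge0_integral_mscale _ _ _ nu _ measurableT (NngNum c0'))//; last first.
  by move=> y _; rewrite lee_fin.
rewrite (eq_measure_integral (pushforward mu mphi_pack)); last first.
  by move=> A mA _ /=; rewrite /mscale/= -muphi.
rewrite ge0_integral_pushforward//; last by move=> y _; rewrite lee_fin.
by apply: ge0_le_integral_any => x _ /=; rewrite ?lee_fin.
Qed.

End change_of_variables.

(** The inverse [psi] scales measures by [c^-1], so the one-sided inequality for [psi] supplies the
    missing half. *)
Lemma ge0_integral_comp d1 d2 (X : measurableType d1) (Y : measurableType d2)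
    (R : realType) (mu : {measure set X -> \bar R})
    (nu : {measure set Y -> \bar R}) (phi : X -> Y) (psi : Y -> X) (c : R)
    (f : Y -> \bar R) :
  measurable_fun setT phi -> measurable_fun setT psi -> cancel psi phi ->
  cancel phi psi -> 0 < c ->
  (forall A, measurable A -> mu (phi @^-1` A) = (c%:E * nu A)%E) ->
  (forall y, (0 <= f y)%E) ->
  (\int[mu]_x f (phi x) = c%:E * \int[nu]_y f y)%E.
Proof.
move=> mphi mpsi psiK phiK c0 muphi f0; apply/eqP; rewrite eq_le.
rewrite ge0_integral_comp_ge// andbT -lee_pdivrMl//.
apply: (@le_trans _ _ (\int[nu]_y (f \o phi) (psi y))%E).
  apply: ge0_integral_comp_ge => //; first by rewrite invr_gt0.
move=> A mA; rewrite -[X in mu X](_ : phi @^-1` (psi @^-1` A) = A).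
    rewrite muphi; last by rewrite -[X in measurable X]setTI; exact: mpsi.
    by rewrite muleA -EFinM mulVf ?gt_eqF// mul1e.
  by rewrite -comp_preimage (_ : psi \o phi = id)//; exact/funext.
by apply: ge0_le_integral_any => y _ /=; rewrite psiK.
Qed.

(** * Lebesgue measure on tuples *)

Section scaling.
Context {R : realType}.
Implicit Types a : R.

(** By uniqueness of Lebesgue measure: [a] times the pushforward gives each half-open interval its
    length. *)
Lemma lebesgue_measure_scale a (A : set (measurableTypeR R)) : 0 < a ->
  measurable A ->
  lebesgue_measure (( *%R a) @^-1` A) = (a^-1%:E * lebesgue_measure A)%E.
Proof.
move=> a0 mA.
have mM : measurable_fun [set: measurableTypeR R]
    (( *%R a) : _ -> measurableTypeR R) by exact: mulrl_measurable.
pose mM_mixin := isMeasurableFun.Build _ _ _ _ _ mM.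
pose mM_pack : {mfun measurableTypeR R >-> measurableTypeR R} :=
  HB.pack ( *%R a) mM_mixin.
have a0' : 0 <= a by exact: ltW.
rewrite [X in _ = (_ * X)%E](@lebesgue_measure_unique R
  (mscale (NngNum a0') (pushforward lebesgue_measure mM_pack))) //.
  by rewrite /= /mscale /= muleA -EFinM mulVf ?gt_eqF// mul1e.
move=> _ [[x y]] _ <-; rewrite /= /mscale /= /pushforward.
rewrite (_ : _ @^-1` _ = `](a^-1 * x), (a^-1 * y)]%classic); last first.
  apply/seteqP; split => z /=; rewrite !in_itv/=.
    by rewrite ltr_pdivrMl// ler_pdivlMl.
  by rewrite ltr_pdivrMl// ler_pdivlMl.
rewrite !lebesgue_measure_itv/= !lte_fin ltr_pM2l ?invr_gt0//.
case: ifPn => _; rewrite ?mule0//.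
by rewrite -!EFinB -EFinM -mulrBr mulVKf ?gt_eqF.
Qed.

(** By uniqueness of the product measure: the pushforward divided by [c1 * c2] has the right values
    on rectangles. *)
Lemma product_measure_preimage d1 d2 (T1 : measurableType d1)
    (T2 : measurableType d2) (m1 : {sigma_finite_measure set T1 -> \bar R})
    (m2 : {sigma_finite_measure set T2 -> \bar R}) (f1 : T1 -> T1)
    (f2 : T2 -> T2) (c1 c2 : R) (X : set (T1 * T2)) :
  measurable_fun setT f1 -> measurable_fun setT f2 -> 0 < c1 -> 0 < c2 ->
  (forall A, measurable A -> m1 (f1 @^-1` A) = (c1%:E * m1 A)%E) ->
  (forall A, measurable A -> m2 (f2 @^-1` A) = (c2%:E * m2 A)%E) ->
  measurable X ->
  (m1 \x m2)%E ((fun x => (f1 x.1, f2 x.2)) @^-1` X) =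
  ((c1 * c2)%:E * (m1 \x m2) X)%E.
Proof.
move=> mf1 mf2 c1_gt0 c2_gt0 hf1 hf2 mX.
set f := (f in f @^-1` X).
have mf : measurable_fun setT f.
  by apply: measurable_fun_pair => /=; apply: measurableT_comp.
pose mf_mixin := isMeasurableFun.Build _ _ _ _ _ mf.
pose mf_pack : {mfun (T1 * T2)%type >-> (T1 * T2)%type} := HB.pack f mf_mixin.
have c_gt0 : 0 < c1 * c2 by rewrite mulr_gt0.
have c'_ge0 : 0 <= (c1 * c2)^-1 by rewrite invr_ge0 ltW.
rewrite [X in _ = (_ * X)%E](@product_measure_unique _ _ _ _ R m1 m2
  (mscale (NngNum c'_ge0) (pushforward (m1 \x m2)%E mf_pack)) _ X)//.
  by rewrite /= /mscale /= muleA -EFinM mulfV ?gt_eqF// mul1e.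
move=> A B mA mB; rewrite /= /mscale /= /pushforward.
rewrite (_ : _ @^-1` _ = (f1 @^-1` A) `*` (f2 @^-1` B))//.
rewrite product_measure1E//; last 2 first.
- by rewrite -[X in measurable X]setTI; exact: mf1.
- by rewrite -[X in measurable X]setTI; exact: mf2.
rewrite [X in (_ * (X * _))%E](hf1 A mA) [X in (_ * (_ * X))%E](hf2 B mB).
have E : (((c1 * c2)^-1)%:E * (c1%:E * c2%:E) = 1 :> \bar R)%E.
  by rewrite -!EFinM mulVf ?gt_eqF.
rewrite muleACA; apply: etrans (muleA _ _ _) _.
by apply: etrans (mul1e _); congr (_ * _)%E.
Qed.

Definition scale_tuple a n (t : n.-tuple (measurableTypeR R)) :
  n.-tuple (measurableTypeR R) := map_tuple ( *%R a) t.

Lemma measurable_scale_tuple a n : measurable_fun setT (scale_tuple a n).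
Proof.
elim: n => [|n IH].
  apply: (eq_measurable_fun (cst [tuple])) => // t _.
  by rewrite [LHS]tuple0 [RHS]tuple0.
rewrite (_ : scale_tuple _ _ = fun t : n.+1.-tuple _ =>
    tuple_cons (a * thead t : measurableTypeR R,
                scale_tuple a n [tuple of behead t])); last first.
  apply/funext => t; rewrite (tuple_eta t); apply/val_inj => /=.
  by rewrite theadE.
apply: measurable_cons.
  apply: (@measurableT_comp _ _ _ _ _ _ ( *%R a : _ -> measurableTypeR R)).
    exact: mulrl_measurable.
  exact: measurable_tnth.
apply: (measurableT_comp IH); exact: (@measurable_behead _ (measurableTypeR R) n).
Qed.

Lemma lebesgue_tuple_scale a n (A : set (n.-tuple (measurableTypeR R))) :
  0 < a -> measurable A ->
  lebesgue_tuple R n (scale_tuple a n @^-1` A) =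
  ((a ^- n)%:E * lebesgue_tuple R n A)%E.
Proof.
move=> a0; elim: n A => [|n IH] A mA.
  rewrite expr0 invr1 mul1e; congr (lebesgue_tuple R 0 _).
  by apply/seteqP; split => t /=; rewrite (tuple0 t) (tuple0 (scale_tuple _ _ _)).
rewrite /lebesgue_tuple/= /tuple_measure_step /pushforward.
rewrite -comp_preimage.
rewrite (_ : _ \o _ = @tuple_cons _ (measurableTypeR R) n \o
    (fun x => ((a * x.1 : measurableTypeR R), scale_tuple a n x.2))); last first.
  by apply/funext => x; exact/val_inj.
rewrite comp_preimage exprS invfM.
have mcA : measurable (@tuple_cons _ (measurableTypeR R) n @^-1` A).
  by rewrite -[X in measurable X]setTI; exact: measurable_tuple_cons.
apply: (@product_measure_preimage _ _ (measurableTypeR R) _ lebesgue_measure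
  (tuple_measure lebesgue_measure n) ( *%R a) (scale_tuple a n)) => //.
- exact: (measurable_scale_tuple a n).
- by rewrite invr_gt0.
- by rewrite invr_gt0 exprn_gt0.
- by move=> B mB; exact: lebesgue_measure_scale.
Qed.

End scaling.

Section cube.
Context {R : realType}.

(** The corner is an infinite sequence, so that dropping the first coordinate is the shift [c \o S]
    and inductions on the dimension need no casts. *)
Definition cube k (c : nat -> R) (r : R) : set (k.-tuple (measurableTypeR R)) :=
  [set t | forall i : 'I_k, c i <= tnth t i <= c i + r].

Lemma tuple_cons_cube k c r :
  @tuple_cons _ (measurableTypeR R) k @^-1` cube k.+1 c r =
  `[c 0%N, c 0%N + r]%classic `*` cube k (c \o S) r.
Proof.
apply/seteqP; split=> [[x t] h|[x t] [/= xc ct] i].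
  split; first by have := h ord0; rewrite /= in_itv.
  by move=> i; have := h (lift ord0 i); rewrite tnthS.
case: (unliftP ord0 i) => [j|] ->; last by rewrite in_itv in xc.
by rewrite tnthS; exact: ct.
Qed.

Lemma measurable_cube k c r : measurable (cube k c r).
Proof.
elim: k c => [|k IH] c.
  by rewrite (_ : cube _ _ _ = setT)//; apply/seteqP; split => // t _ [].
rewrite (_ : cube _ _ _ = @tuple_uncons _ (measurableTypeR R) k @^-1`
    (@tuple_cons _ (measurableTypeR R) k @^-1` cube k.+1 c r)); last first.
  rewrite -comp_preimage (_ : _ \o _ = id)//; apply/funext => t /=.
  by rewrite /tuple_cons/= [RHS]tuple_eta; exact/val_inj.
rewrite tuple_cons_cube -[X in measurable X]setTI.
apply: measurable_tuple_uncons => //; apply: measurableX => //.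
Qed.

Lemma lebesgue_tuple_cube k c r : 0 <= r ->
  lebesgue_tuple R k (cube k c r) = (r ^+ k)%:E.
Proof.
move=> r0; elim: k c => [|k IH] c.
  by rewrite /lebesgue_tuple/= diracE mem_set//= => -[].
rewrite /lebesgue_tuple/= /tuple_measure_step /pushforward tuple_cons_cube.
rewrite product_measure1E//; last exact: measurable_cube.
rewrite [X in (_ * X)%E]IH [X in (X * _)%E](lebesgue_measure_itv `[c 0%N, _]).
rewrite /= lte_fin ltrDl.
rewrite -EFinB addrAC subrr add0r; case: ltgtP r0 => // [r0 _|<- _].
  by rewrite -EFinM exprS.
by rewrite mul0e expr0n.
Qed.

End cube.

(** * Hausdorff measure of the sphere *)

Section frobenius.
Context {R : realType} {n m : nat}.
Implicit Types x y z : 'M[R]_(n, m).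

Lemma mxdotE x y : mxdot x y = \sum_i \sum_j x i j * y i j.
Proof.
rewrite /mxdot /mxtrace exchange_big/=; apply: eq_bigr => j _.
by rewrite mxE; apply: eq_bigr => i _; rewrite mxE.
Qed.

Lemma mxdotC x y : mxdot x y = mxdot y x.
Proof.
by rewrite !mxdotE; apply: eq_bigr => i _; apply: eq_bigr => j _; rewrite mulrC.
Qed.

Lemma mxdotDr x y z : mxdot x (y + z) = mxdot x y + mxdot x z.
Proof. by rewrite /mxdot mulmxDr mxtraceD. Qed.

Lemma mxdotZr a x y : mxdot x (a *: y) = a * mxdot x y.
Proof. by rewrite /mxdot -scalemxAr mxtraceZ. Qed.

Lemma mxdotDl x y z : mxdot (x + y) z = mxdot x z + mxdot y z.
Proof. by rewrite !(mxdotC _ z) mxdotDr. Qed.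

Lemma mxdotZl a x y : mxdot (a *: x) y = a * mxdot x y.
Proof. by rewrite !(mxdotC _ y) mxdotZr. Qed.

Lemma mxdot_ge0 x : 0 <= mxdot x x.
Proof. by rewrite mxdotE; do 2! apply: sumr_ge0 => ? _; rewrite -expr2 sqr_ge0. Qed.

Lemma sqr_mxnorm2 x : mxnorm2 x ^+ 2 = mxdot x x.
Proof. by rewrite sqr_sqrtr// mxdot_ge0. Qed.

Lemma mxnorm2_ge0 x : 0 <= mxnorm2 x.
Proof. exact: sqrtr_ge0. Qed.

Lemma le_coord_mxnorm2 x i j : `|x i j| <= mxnorm2 x.
Proof.
rewrite -ler_sqr ?nnegrE ?normr_ge0 ?mxnorm2_ge0// sqr_mxnorm2 real_normK ?num_real//.
rewrite mxdotE (bigD1 i)//= (bigD1 j)//= -expr2 -addrA lerDl addr_ge0//.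
  by apply: sumr_ge0 => ? _; rewrite -expr2 sqr_ge0.
by do 2! apply: sumr_ge0 => ? _; rewrite -expr2 sqr_ge0.
Qed.

(** Cauchy-Schwarz: when neither norm vanishes, the square of the norm of |y| x - |x| y is 2 |x| |y|
    (|x| |y| - x.y), and it is nonnegative. *)
Lemma mxdot_le x y : mxdot x y <= mxnorm2 x * mxnorm2 y.
Proof.
have [x0|x0] := eqVneq (mxnorm2 x) 0.
  rewrite x0 mul0r mxdotE big1// => i _; rewrite big1// => j _.
  have := le_coord_mxnorm2 x i j; rewrite x0 normr_le0 => /eqP ->.
  by rewrite mul0r.
have [y0|y0] := eqVneq (mxnorm2 y) 0.
  rewrite y0 mulr0 mxdotE big1// => i _; rewrite big1// => j _.
  have := le_coord_mxnorm2 y i j; rewrite y0 normr_le0 => /eqP ->.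
  by rewrite mulr0.
have xy_gt0 : 0 < mxnorm2 x * mxnorm2 y by rewrite mulr_gt0// lt0r ?x0 ?y0 mxnorm2_ge0.
have := mxdot_ge0 (mxnorm2 y *: x + (- mxnorm2 x) *: y).
rewrite !(mxdotDl, mxdotDr, mxdotZl, mxdotZr) -!sqr_mxnorm2 (mxdotC y x).
set a := mxnorm2 x in xy_gt0 *; set b := mxnorm2 y in xy_gt0 *; set c := mxdot x y.
rewrite (_ : _ + _ = (a * b) * (2 * (a * b - c))); last by ring.
by rewrite pmulr_rge0// pmulr_rge0// subr_ge0.
Qed.

Lemma le_mxnorm2D x y : mxnorm2 (x + y) <= mxnorm2 x + mxnorm2 y.
Proof.
rewrite -ler_sqr ?nnegrE ?addr_ge0 ?mxnorm2_ge0// sqr_mxnorm2.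
rewrite !(mxdotDl, mxdotDr) (mxdotC y x) -!sqr_mxnorm2.
by have := mxdot_le x y; nra.
Qed.

Lemma mxnorm2N x : mxnorm2 (- x) = mxnorm2 x.
Proof.
by rewrite /mxnorm2 -scaleN1r mxdotZl mxdotZr mulrA mulrNN !mul1r.
Qed.

Lemma le_dist_mxnorm2 x y : `|mxnorm2 x - mxnorm2 y| <= mxnorm2 (x - y).
Proof.
have h (u v : 'M[R]_(n, m)) : mxnorm2 u - mxnorm2 v <= mxnorm2 (u - v).
  by rewrite lerBlDr; have := le_mxnorm2D (u - v) v; rewrite subrK.
by rewrite ler_norml h andbT lerNl opprB -(mxnorm2N (x - y)) opprB h.
Qed.

End frobenius.

(** * Caratheodory measurability of the sphere *)

Section caratheodory_zero_set.
Context {R : realType} {T : Type}.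
Variables (mu : {outer_measure set T -> \bar R}) (rho : T -> R).
Hypothesis rho_ge0 : forall x, 0 <= rho x.
Hypothesis mu_separated : forall (A B : set T) (a b : R), a < b ->
  (forall x, A x -> rho x <= a) -> (forall x, B x -> b <= rho x) ->
  (mu A + mu B <= mu (A `|` B))%E.

Let s (k : nat) : R := k.+1%:R^-1.

Let s_lt i j : (i < j)%N -> s j < s i.
Proof. by move=> ij; rewrite ltf_pV2 ?posrE ?ltr0n// ltr_nat. Qed.

(* Split the complement of the zero set into the rings where rho lies between
   consecutive odd terms of 1/(k+1).  The rings of even index are pairwise
   separated, and so are those of odd index; hence the measures of the rings are
   summable and those near the zero set can be neglected. *)
Lemma caratheodory_zero_set : mu.-caratheodory [set x | rho x = 0].
Proof.
apply: le_caratheodory_measurable => X; set S := [set x | _].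
have [->|Xoo] := eqVneq (mu X) +oo%E; first exact: leey.
pose ring k := X `&` [set x | s k.*2.+3 < rho x <= s k.*2.+1].
have sum_parity b N :
    (\sum_(j < N) mu (ring (j.*2 + b)%N) <= mu X)%E.
  (* The induction needs this sharper bound. The even term [s (N.*2 + b).*2] lies strictly between
     the ring of index [N.*2 + b] and the earlier rings of the same parity, so [mu_separated]
     applies. *)
  apply: (@le_trans _ _ (mu (X `&` [set x | s (N.*2 + b).*2 <= rho x]))); last first.
    by apply: le_outer_measure; exact: subIsetl.
  elim: N => [|N IH]; first by rewrite big_ord0 outer_measure_ge0.
  rewrite big_ord_recr/=; apply: le_trans (leeD2r _ IH) _; rewrite addeC.
  apply: le_trans (mu_separated _ _ _ _ (s_lt _ _ (ltnSn (N.*2 + b).*2)) _ _) _.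
  - by move=> x [_ /= /andP[]].
  - by move=> x [].
  - apply: le_outer_measure => x [[Xx /= /andP[h _]]|[Xx /= h]]; split => //=.
      by apply: ltW; apply: le_lt_trans h; rewrite ltW//; apply: s_lt; lia.
    by apply: le_trans h; rewrite ltW//; apply: s_lt; lia.
have split_parity (f : nat -> \bar R) N : (\sum_(j < N.*2) f j =
    \sum_(j < N) f (j.*2 + 0)%N + \sum_(j < N) f (j.*2 + 1)%N)%E.
  elim: N => [|N IH]; first by rewrite !big_ord0 adde0.
  by rewrite doubleS !big_ord_recr/= IH addn0 addn1 -!addeA; congr adde; rewrite addeCA.
have sum_fin : (\sum_(0 <= j <oo) mu (ring j) < +oo)%E.
  apply: (@le_lt_trans _ _ (mu X + mu X)%E); last first.
    by rewrite lte_add_pinfty// ltey.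
  apply: lime_le; first by apply: is_cvg_nneseries => *; exact: outer_measure_ge0.
  apply: nearW => N; rewrite big_mkord.
  apply: (@le_trans _ _ (\sum_(j < N.*2) mu (ring j))%E); last first.
    by rewrite (split_parity (fun j => mu (ring j))) leeD.
  rewrite -!(big_mkord xpredT (fun j => mu (ring j))).
  by apply: lee_sum_nneg_natr => [*|]; rewrite ?outer_measure_ge0// -addnn leq_addr.
have tail := nneseries_tail_cvg sum_fin (fun k _ => outer_measure_ge0 mu (ring k)).
have main k : (mu (X `&` S) + mu (X `&` ~` S) <=
    mu X + \sum_(k <= j <oo) mu (ring j))%E.
  (* [P] is separated from the zero set, and the rest of the complement is covered by the rings of
     index at least [k], whose total measure is a tail of a convergent series. *)
  pose P := X `&` [set x | s k.*2.+1 <= rho x].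
  pose F j := ring (j + k)%N.
  have XSP : (mu (X `&` S) + mu P <= mu X)%E.
    have s0 : 0 < s k.*2.+1 by rewrite invr_gt0 ltr0n.
    apply: le_trans (mu_separated _ _ _ _ s0 _ _) _.
    - by move=> x [_ /= ->].
    - by move=> x [].
    - by apply: le_outer_measure => x [] [].
  have XCS : X `&` ~` S `<=` P `|` \bigcup_j F j.
    move=> x [Xx /eqP /= rx0].
    have rx : 0 < rho x by rewrite lt0r rx0 rho_ge0.
    have [h|h] := lerP (s k.*2.+1) (rho x); [by left|right].
    have exN : exists N, s N.*2.+1 < rho x.
      exists (Num.truncn (rho x)^-1).
      rewrite /s invf_plt ?posrE ?ltr0n//.
      apply: (lt_le_trans (truncnS_gt _)); rewrite ler_nat.
      by rewrite ltnS (leq_trans _ (leqnSn _))// -addnn leq_addr.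
    (* The least index with this property is some [N.+1], and by minimality x lies in the ring of
       index [N]. It is not 0, because [rho x] is below [s k.*2.+1 <= s 1]. *)
    case: (ex_minnP exN) => -[|N] hN minN.
      exfalso; move: h; apply/negP; rewrite -leNgt; apply: le_trans (ltW hN).
      by case: (k) => // k'; apply/ltW/s_lt.
    have hN' : rho x <= s N.*2.+1.
      by rewrite leNgt; apply/negP => /minN; rewrite ltnn.
    exists (N - k)%N => //; rewrite /F subnK; first by split => //=; rewrite hN.
    rewrite leqNgt; apply/negP => Nk; move: h; apply/negP; rewrite -leNgt.
    apply: le_trans (ltW hN); have [->//|] := eqVneq k N.+1.
    by move=> kN; apply/ltW/s_lt; lia.
  have muF : (mu (\bigcup_j F j) <= \sum_(k <= j <oo) mu (ring j))%E.
    apply: le_trans (outer_measure_sigma_subadditive mu F) _.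
    rewrite -(nneseries_addn k (f := fun j => mu (ring j)))// => i.
    exact: outer_measure_ge0.
  apply: (@le_trans _ _ (mu (X `&` S) + (mu P + mu (\bigcup_j F j)))%E).
    rewrite leeD2l//; apply: le_trans (le_outer_measure mu _ _ XCS) _.
    exact: outer_measureU2.
  by rewrite addeA leeD.
have cvgX : (mu X + \sum_(k <= j <oo) mu (ring j))%E @[k --> \oo] --> mu X.
  rewrite -[X in _ --> X]adde0; apply: cvgeD => //; last exact: cvg_cst.
  by rewrite fin_num_adde_defl.
rewrite -(cvg_lim _ cvgX)//; apply: lime_ge; first by apply/cvg_ex; exists (mu X).
exact: nearW.
Qed.

End caratheodory_zero_set.

Section hausdorff_metric.
Context {R : realType} {n m : nat}.
Variable k : nat.
Implicit Types A B : set 'M[R]_(n, m).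
Local Open Scope ereal_scope.

Lemma le_hausdorff_pre (d1 d2 : R) A : (d1 <= d2)%R ->
  hausdorff_pre k d2 A <= hausdorff_pre k d1 A.
Proof.
move=> d12; apply: le_ereal_inf_tmp => _ [E [dE AE] <-].
apply: ereal_inf_lbound; exists E => //; split => // i.
by apply: le_trans (dE i) _; rewrite lee_fin.
Qed.

(** A set of diameter at most d < e cannot meet both A and B. So a cover of the union splits into a
    cover [F A] of A and a cover [F B] of B, where sets that miss the target are replaced by the
    empty set, of gauge 0. *)
Lemma hausdorff_pre_separated (d e : R) A B : (d < e)%R ->
  (forall x y, A x -> B y -> (e <= mxnorm2 (x - y))%R) ->
  hausdorff_pre k d A + hausdorff_pre k d B <= hausdorff_pre k d (A `|` B).
Proof.
move=> de ABe; apply: le_ereal_inf_tmp => _ [E [dE ABE] <-].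
pose F C i := if `[< E i `&` C !=set0 >] then E i else set0.
have coverF C : C `<=` \bigcup_i E i -> hausdorff_cover d C (F C).
  move=> CE; split.
    move=> i; rewrite /F; case: asboolP => // _.
    by apply: ge_ereal_sup => _ [z [] //].
  move=> x Cx; have [i _ Eix] := CE x Cx; exists i => //.
  by rewrite /F; case: asboolP => // -[]; exists x.
have leF C : C `<=` \bigcup_i E i ->
    hausdorff_pre k d C <= \sum_(i <oo) hausdorff_gauge k (F C i).
  by move=> CE; apply: ereal_inf_lbound; exists (F C) => //; exact: coverF.
apply: (@le_trans _ _ (\sum_(i <oo) hausdorff_gauge k (F A i) +
                       \sum_(i <oo) hausdorff_gauge k (F B i))).
  by apply: leeD; apply: leF => x Cx; apply: ABE; [left|right].
rewrite -nneseriesD; do ?[by move=> i _ _; exact: hausdorff_gauge_ge0].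
apply: lee_nneseries => [i _ _|i _].
  by rewrite adde_ge0// hausdorff_gauge_ge0.
rewrite /F; case: asboolP => [[x [Ex Ax]]|_].
  case: asboolP => [[y [Ey By]]|_]; last by rewrite hausdorff_gauge0 adde0.
  exfalso; suff : e%:E <= d%:E by rewrite lee_fin leNgt de.
  apply: le_trans (dE i); apply: (@le_trans _ _ (mxnorm2 (x - y))%:E).
    by rewrite lee_fin ABe.
  by apply: ereal_sup_ubound; exists (x, y).
rewrite hausdorff_gauge0 add0e; case: asboolP => // _.
by rewrite hausdorff_gauge0 hausdorff_gauge_ge0.
Qed.

(** The premeasures grow as the scale shrinks, so scales [d1] for A and [d2] for B can be replaced
    by a common one, which the minimum with e / 2 keeps below e. Once the infinite case is set
    aside, the two suprema are taken one after the other by subtracting finite terms. *)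
Lemma hausdorff_separated (e : R) A B : (0 < e)%R ->
  (forall x y, A x -> B y -> (e <= mxnorm2 (x - y))%R) ->
  hausdorff k A + hausdorff k B <= hausdorff k (A `|` B).
Proof.
move=> e0 ABe.
have [->|ABoo] := eqVneq (hausdorff k (A `|` B)) +oo; first exact: leey.
have leAB C : C `<=` A `|` B -> hausdorff k C <= hausdorff k (A `|` B).
  exact: (le_outer_measure (hausdorff_outer k)).
have fin_sub x : 0 <= x -> x <= hausdorff k (A `|` B) -> x \is a fin_num.
  by move=> x0 xAB; rewrite ge0_fin_numE// (le_lt_trans xAB)// ltey.
have H0 (C : set 'M[R]_(n, m)) : 0 <= hausdorff k C.
  exact: (outer_measure_ge0 (hausdorff_outer k)).
have pre_le (d : R) (C : set 'M[R]_(n, m)) :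
    (0 < d)%R -> hausdorff_pre k d C <= hausdorff k C.
  by move=> d0; apply: ereal_sup_ubound; exists d.
have key (d1 d2 : R) : (0 < d1)%R -> (0 < d2)%R ->
    hausdorff_pre k d1 A + hausdorff_pre k d2 B <= hausdorff k (A `|` B).
  move=> d10 d20; pose d := Num.min (Num.min d1 d2) (e / 2)%R.
  have d0 : (0 < d)%R by rewrite !lt_min d10 d20 divr_gt0.
  have de : (d < e)%R by rewrite gt_min ltr_pdivrMr// ltr_pMr ?ltr1n ?orbT.
  apply: le_trans (pre_le _ (A `|` B) d0).
  apply: le_trans (hausdorff_pre_separated _ _ _ _ de ABe).
  by apply: leeD; apply: le_hausdorff_pre; rewrite !ge_min lexx ?orbT.
have finA : hausdorff k A \is a fin_num by apply: fin_sub => //; exact: leAB.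
have finB (d2 : R) : (0 < d2)%R -> hausdorff_pre k d2 B \is a fin_num.
  move=> d20; apply: fin_sub; first exact: hausdorff_pre_ge0.
  by apply: le_trans (pre_le _ B d20) _; exact: leAB.
rewrite addeC -leeBrDr//; apply: ge_ereal_sup => _ [d2 d20 <-].
rewrite leeBrDr// addeC -leeBrDr ?finB//.
apply: ge_ereal_sup => _ [d1 d10 <-].
by rewrite leeBrDr ?finB// key.
Qed.

(** The sphere is the zero set of the function | |x| - 1 |. It is 1-Lipschitz, so the sets where it
    is at most a and at least b are at distance at least b - a. *)
Lemma caratheodory_mxsphere :
  (hausdorff_outer k).-caratheodory (@mxsphere R n m).
Proof.
rewrite (_ : mxsphere = [set x | `|mxnorm2 x - 1|%R = 0%R]); last first.
  apply/seteqP; split => x /=; first by rewrite /mxsphere/= => ->; rewrite subrr normr0.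
  by move/normr0P; rewrite subr_eq0 => /eqP.
apply: caratheodory_zero_set => // A B a b ab Aa Bb.
apply: (@hausdorff_separated (b - a)); first by rewrite subr_gt0.
move=> x y /Aa xa /Bb yb.
apply: le_trans (le_dist_mxnorm2 _ _).
rewrite distrC; apply: le_trans (lerB yb xa) _.
by apply: le_trans (lerB_dist _ _) _; rewrite opprB addrA subrK.
Qed.

End hausdorff_metric.

(** * Projection of the sphere and positivity of its area *)

Section coordinates.
Context {R : realType} {n m : nat}.
Implicit Types x y : 'M[R]_(n, m).

(* entries in row-major order, with junk value 0 beyond the last one *)
Definition mxcoord x (l : nat) : R :=
  if insub l is Some j then mxvec x 0 j else 0.

Lemma mxcoord_ord x (j : 'I_(n * m)) : mxcoord x j = mxvec x 0 j.
Proof. by rewrite /mxcoord valK. Qed.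

Lemma le_mxcoord x y l : `|mxcoord x l - mxcoord y l| <= mxnorm2 (x - y).
Proof.
rewrite /mxcoord; case: insubP => [j _ _|_]; last by rewrite subrr normr0 mxnorm2_ge0.
case/mxvec_indexP: j => i j; rewrite !mxvecE.
by have := le_coord_mxnorm2 (x - y) i j; rewrite !mxE.
Qed.

Lemma mxdot_mxvec x : mxdot x x = \sum_(j < n * m) mxvec x 0 j ^+ 2.
Proof.
rewrite mxdotE pair_bigA/= (reindex _ (curry_mxvec_bij n m))/=.
by apply: eq_bigr => -[i j] _; rewrite /= mxvecE expr2.
Qed.

(** The last coordinate is the square root of what the squares of the others leave of 1. *)
Lemma mxsphere_lift (t : nat -> R) : (0 < n * m)%N ->
  \sum_(i < (n * m).-1) t i ^+ 2 <= 1 ->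
  exists2 u, @mxsphere R n m u & forall l, (l < (n * m).-1)%N -> mxcoord u l = t l.
Proof.
move=> nm0 t1; set k := (n * m).-1 in t1 *.
pose v l := if (l < k)%N then t l else Num.sqrt (1 - \sum_(i < k) t i ^+ 2).
pose u : 'M[R]_(n, m) := vec_mx (\row_(j < n * m) v j).
exists u; last first.
  move=> l lk; have ln : (l < n * m)%N by rewrite (leq_trans lk)// /k leq_pred.
  by rewrite (mxcoord_ord u (Ordinal ln)) vec_mxK mxE/= /v lk.
rewrite /mxsphere/= /mxnorm2 mxdot_mxvec.
under eq_bigr do rewrite vec_mxK mxE.
rewrite -(big_mkord xpredT (fun j => v j ^+ 2)) -(prednK nm0) -/k.
rewrite big_nat_recr//= {2}/v ltnn sqr_sqrtr ?subr_ge0//.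
rewrite big_mkord (eq_bigr (fun i : 'I_k => t i ^+ 2)); last first.
  by move=> i _; rewrite /v ltn_ord.
by rewrite addrC subrK sqrtr1.
Qed.

End coordinates.

Section unit_ball.
Context {R : realType}.

(** Each of the k squares is at most 1/(k+1). The edge 1/(k+1) rather than 1/k covers k = 0 as
    well. *)
Lemma cube_sum_sqr k (t : k.-tuple (measurableTypeR R)) :
  cube k (fun=> 0) k.+1%:R^-1 t -> \sum_(i < k) (tnth t i : R) ^+ 2 <= 1.
Proof.
move=> ct; have k0 : 0 < k.+1%:R :> R by rewrite ltr0n.
apply: (@le_trans _ _ (\sum_(i < k) (k.+1%:R^-1 : R))).
  apply: ler_sum => i _; have /andP[t0] := ct i; rewrite add0r => t1.
  apply: (@le_trans _ _ (k.+1%:R^-1 ^+ 2)); first by rewrite lerXn2r ?nnegrE ?invr_ge0.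
  rewrite expr2 ler_piMl ?invr_ge0// invf_le1// ler1n//.
rewrite sumr_const card_ord -[_ *+ k]mulr_natl ler_pdivrMr// mul1r ler_nat//.
Qed.

Lemma unit_ball_volume_ge k :
  ((k.+1%:R^-1 ^+ k)%:E <= unit_ball_volume R k)%E.
Proof.
rewrite -(@lebesgue_tuple_cube R k (fun=> 0)) ?invr_ge0//.
apply: le_measure; rewrite ?inE.
- exact: measurable_cube.
- rewrite -[X in measurable X]setTI.
  have mf : measurable_fun [set: k.-tuple (measurableTypeR R)]
      (fun t => \sum_(i < k) (tnth t i : R) ^+ 2).
    apply: measurable_sum => i; apply: measurable_funX; exact: measurable_tnth.
  rewrite (_ : [set _ | _] = (fun t : k.-tuple (measurableTypeR R) =>
      \sum_(i < k) (tnth t i : R) ^+ 2) @^-1` `]-oo, 1]%classic).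
    by apply: mf => //; exact: measurable_itv.
  by apply/seteqP; split => t /=; rewrite in_itv.
- by move=> t; exact: cube_sum_sqr.
Qed.

End unit_ball.

Section sphere_area.
Context {R : realType} {n m : nat}.
Local Open Scope ereal_scope.
Hypothesis nm_gt0 : (0 < n * m)%N.
Let k := (n * m).-1.
(** [w] is the volume of a cube inside the unit ball. It serves both as a lower bound for the
    normalizing factor of the gauge and as the volume that the shadows of a cover of the sphere must
    fill. *)
Let w : R := (k.+1%:R^-1 ^+ k)%R.

Let w_gt0 : (0 < w)%R.
Proof. by rewrite exprn_gt0// invr_gt0 ltr0n. Qed.

(* B contains the points t whose coordinates are the first nm - 1 ones of some
   matrix in E. *)
Lemma shadow_cover (E : set 'M[R]_(n, m)) : mxdiam E <= 1%:E ->
  exists B : set (k.-tuple (measurableTypeR R)),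
  [/\ measurable B,
      forall y t, E y -> (forall i : 'I_k, mxcoord y i = tnth t i) -> B t &
      (w * 4^-1 ^+ k)%:E * lebesgue_tuple R k B <= hausdorff_gauge k E].
Proof.
move=> dE; have [->|/set0P[x Ex]] := eqVneq E set0.
  by exists set0; split => //; rewrite measure0 mule0 hausdorff_gauge_ge0.
have dist_le y : E y -> (mxnorm2 (x - y))%:E <= mxdiam E.
  by move=> Ey; apply: ereal_sup_ubound; exists (x, y).
have d0 : 0 <= mxdiam E.
  by apply: le_trans (dist_le _ Ex); rewrite lee_fin mxnorm2_ge0.
(* The bound of the diameter by 1 makes it a real number. *)
have dfin : mxdiam E \is a fin_num by rewrite ge0_fin_numE// (le_lt_trans dE)// ltry.
have r0 : (0 <= fine (mxdiam E))%R by exact: fine_ge0.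
have drE : mxdiam E = (fine (mxdiam E))%:E by rewrite fineK.
set r := fine _ in r0 drE.
(* The cube is centred at the coordinates of x, with half-edge r: no coordinate of a point of E
   differs by more than r from that of x. *)
exists (cube k (fun l => mxcoord x l - r)%R (2 * r)%R); split.
- exact: measurable_cube.
- move=> y t Ey yt i; rewrite -yt.
  have := le_trans (le_mxcoord x y i); move=> /(_ r).
  have := dist_le _ Ey; rewrite drE lee_fin => h /(_ h).
  by rewrite ler_distl => /andP[h1 h2]; apply/andP; split; lra.
- rewrite lebesgue_tuple_cube ?mulr_ge0// /hausdorff_gauge ifN; last first.
    by apply/set0P; exists x.
  rewrite drE.
  (* The factor 4^-k turns the volume (2r)^k of the cube into the power (r/2)^k of the gauge. *)
  have E1 : (w * 4^-1 ^+ k)%:E * ((2 * r) ^+ k)%:E =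
      w%:E * ((2^-1)%:E * r%:E) ^+ k :> \bar R.
    by rewrite -EFinM -EFin_expe -!EFinM -mulrA -exprMn; congr (_ * _ ^+ _)%:E; field.
  rewrite [leLHS]E1; apply: lee_wpmul2r; last exact: unit_ball_volume_ge.
  by rewrite expe_ge0// -EFinM lee_fin mulr_ge0.
Qed.

Lemma hausdorff_mxsphere_gt0 : 0 < hausdorff k (@mxsphere R n m).
Proof.
pose c := (w * 4^-1 ^+ k)%R.
have c0 : (0 < c)%R by rewrite mulr_gt0// exprn_gt0.
apply: (@lt_le_trans _ _ (c * w)%:E); first by rewrite lte_fin mulr_gt0.
(* A single scale is enough, [hausdorff] being a supremum over all scales; the value 1 is the one
   that [shadow_cover] accepts. *)
apply: (@le_trans _ _ (hausdorff_pre k 1 (@mxsphere R n m))); last first.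
  by apply: ereal_sup_ubound; exists 1%R => //=.
apply: le_ereal_inf_tmp => _ [E [dE SE] <-].
have /choice[B hB] := fun i => shadow_cover (E i) (dE i).
apply: (@le_trans _ _ (\sum_(i <oo) (c%:E * lebesgue_tuple R k (B i)))); last first.
  apply: lee_nneseries => [i _ _|i _]; last by have [] := hB i.
  by rewrite mule_ge0 ?lee_fin// ltW.
rewrite nneseriesZl//= EFinM lee_pmul2l//.
(* The remaining factor [w] is the volume of the cube in the unit ball. Each point of that cube
   lifts to the sphere, hence lies in the shadow of a member of the cover. *)
rewrite -(@lebesgue_tuple_cube R k (fun=> 0%R)) ?invr_ge0//.
apply: measure_sigma_subadditive => //.
- by move=> i; have [] := hB i.
- exact: measurable_cube.
move=> t /cube_sum_sqr t1.
pose t' l : R := nth 0%R (t : seq R) l.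
have tt' (i : 'I_k) : t' i = tnth t i by rewrite (tnth_nth 0%R).
have t'1 : (\sum_(i < k) t' i ^+ 2 <= 1)%R by under eq_bigr do rewrite tt'.
have [u /SE[i _ Eiu] ut] := mxsphere_lift t' nm_gt0 t'1.
exists i => //; have [_ hBi _] := hB i; apply: (hBi u) => // j.
by rewrite ut.
Qed.

End sphere_area.

(** * Bump functions *)

Section flat.
Context {R : realType}.
Implicit Types (N : nat) (s x : R).

(* The functions s^-N exp(-1/s), extended by 0, span a space that is stable under
   differentiation: only the value at 0 of the derivative needs an estimate. *)
Definition flat N s : R := if 0 < s then s^-1 ^+ N * expR (- s^-1) else 0.

Lemma flat_ge0 N s : 0 <= flat N s.
Proof.
rewrite /flat; case: ifP => // s0.
by rewrite mulr_ge0 ?expR_ge0// exprn_ge0// invr_ge0 ltW.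
Qed.

(** With M = N + 2 and y = 1/(sM), raising y <= exp y to the power M gives s^-M <= M^M exp(1/s). The
    exponent M leaves the factor s^2, which forces the derivative at 0 to vanish. *)
Lemma flat_le_sqr N s : flat N s <= (N.+2)%:R ^+ N.+2 * s ^+ 2.
Proof.
rewrite /flat; case: ifP => [s0|_]; last by rewrite mulr_ge0 ?sqr_ge0 ?exprn_ge0.
have h : s^-1 / N.+2%:R <= expR (s^-1 / N.+2%:R).
  by apply: le_trans (expR_ge1Dx _); rewrite lerDr ler01.
have {}h : (s^-1 / N.+2%:R) ^+ N.+2 <= expR s^-1.
  have -> : expR s^-1 = expR (s^-1 / N.+2%:R) ^+ N.+2.
    by rewrite -expRM_natr divfK// pnatr_eq0.
  by rewrite lerXn2r ?nnegrE ?expR_ge0// divr_ge0// invr_ge0 ltW.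
rewrite expRN; apply: (@le_trans _ _ (s^-1 ^+ N / (s^-1 / N.+2%:R) ^+ N.+2)).
  rewrite ler_pM2l ?exprn_gt0 ?invr_gt0// lef_pV2// posrE ?expR_gt0//.
  by rewrite exprn_gt0// divr_gt0 ?invr_gt0// ltr0n.
rewrite expr_div_n invf_div !exprVn invrK.
rewrite le_eqVlt; apply/orP; left; apply/eqP.
rewrite mulrCA; congr (_ * _).
by rewrite -addn2 exprD mulKf// expf_neq0// gt_eqF.
Qed.

Lemma is_derive_flat N s :
  is_derive s 1 (flat N) (- N%:R * flat N.+1 s + flat N.+2 s).
Proof.
have [s0|s0|->] := ltgtP s 0.
- rewrite /flat !(ltNge 0 s) !(ltW s0)/= mulr0 addr0.
  apply: (near_eq_is_derive (f := cst 0)).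
    by near=> t; rewrite lt_gtF//; near: t; exact: lt_nbhsl.
- rewrite /flat s0.
  apply: (near_eq_is_derive (f := fun s => s^-1 ^+ N * expR (- s^-1))).
    by near=> t; rewrite ifT//; near: t; exact: lt_nbhsr.
  have sn0 : s != 0 by rewrite gt_eqF.
  have dV : is_derive s 1 (fun t : R => t^-1) (- s ^- 2).
    by have := is_deriveV sn0 (is_derive_id s (1 : R)); rewrite /GRing.scale/= mulr1.
  have dX : is_derive s 1 (fun t : R => t^-1 ^+ N) (- N%:R * s^-1 ^+ N.+1).
    have := is_deriveX N dV; rewrite (_ : _ ^+ N = (fun t => t^-1 ^+ N)); last first.
      by apply/funext => t; rewrite fctE.
    move=> d; apply: (is_derive_eq d); rewrite /GRing.scale/= -exprVn.
    by case: (N) => [|N']; rewrite ?oppr0 ?mul0r// !exprS /=; ring.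
  have dE : is_derive s 1 (fun t : R => expR (- t^-1)) (s ^- 2 * expR (- s^-1)).
    have dN : is_derive s 1 (fun t : R => - t^-1) (s ^- 2).
      by apply: (is_derive_eq (is_deriveN dV)); rewrite opprK.
    have dC := @is_derive1_comp _ expR _ s _ _ (is_derive_expR _) dN.
    by apply: (is_derive_eq dC); rewrite mulrC.
  apply: (is_derive_eq (is_deriveM dX dE)).
  by rewrite /GRing.scale/= -exprVn !exprS expr0; ring.
- have f0 M : flat M 0 = 0 by rewrite /flat ltxx.
  rewrite !f0 mulr0 addr0.
  (* The difference quotient at 0 is at most C |h| by [flat_le_sqr]; the formula for the derivative
     also gives 0 there. *)
  have h : h^-1 *: ((flat N \o shift 0) (h *: 1) - flat N 0) @[h --> 0^'] --> (0 : R).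
    set C : R := N.+2%:R ^+ N.+2.
    have C0 : 0 <= C by rewrite exprn_ge0.
    apply/cvgr0Pnorm_le => e e0; near=> h.
    rewrite /= f0 subr0 addr0 /GRing.scale/= mulr1 normrM normfV.
    have h0 : 0 < `|h| by rewrite normr_gt0; near: h; exact: nbhs_dnbhs_neq.
    rewrite ler_pdivrMl// (ger0_norm (flat_ge0 _ _)).
    apply: (le_trans (flat_le_sqr _ _)); rewrite -/C.
    rewrite -(normr_id h) -real_normK ?num_real// expr2 mulrCA normr_id ler_pM2l//.
    apply: (@le_trans _ _ ((C + 1) * `|h|)); first by rewrite ler_wpM2r// lerDl.
    rewrite mulrC -ler_pdivlMr ?ltr_wpDl//.
    near: h; apply: dnbhs0_le; by rewrite divr_gt0// ltr_wpDl.
  by apply: DeriveDef; [apply/cvg_ex; exists 0|exact: cvg_lim h].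
Unshelve. all: by end_near. Qed.

Lemma flat_ge1 s : 1 <= s -> expR (- 1) <= flat 0 s.
Proof.
move=> s1; have s0 : 0 < s by exact: lt_le_trans s1.
by rewrite /flat s0 expr0 mul1r ler_expR lerN2 invf_le1.
Qed.

Lemma flat_le0 N s : s <= 0 -> flat N s = 0.
Proof. by rewrite /flat leNgt => /negbTE ->. Qed.

End flat.

(** * Closure properties of functions of class C^k *)

Section Ck_closure.
Context {R : realType} {n : nat}.
Implicit Types f g : 'cV[R]_n -> R.

Lemma Ck_continuous k f : Ck k f -> continuous f.
Proof. by case: k => [|k] []. Qed.

Lemma Ck_cst k c : Ck k (fun _ : 'cV[R]_n => c).
Proof.
elim: k c => [|k IH] c; split => //; try exact: cst_continuous.
move=> i; split=> [x|]; first exact: derivable_cst.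
rewrite (_ : partial i _ = fun=> 0); first exact: IH.
by apply/funext => x; rewrite /partial derive_cst.
Qed.

Lemma CkS k f : Ck k.+1 f -> Ck k f.
Proof.
elim: k f => [|k IH] f [cf df]; split => // i.
by have [dfi Cki] := df i; split => //; exact: IH.
Qed.

Lemma CkD k f g : Ck k f -> Ck k g -> Ck k (fun x => f x + g x).
Proof.
elim: k f g => [|k IH] f g; first by move=> [cf _] [cg _]; split => // x;
  exact: (cvgD (cf x) (cg x)).
move=> [cf df] [cg dg]; split; first by move=> x; exact: (cvgD (cf x) (cg x)).
move=> i; have [dfi Cfi] := df i; have [dgi Cgi] := dg i; split.
  by move=> x; apply: derivableD.
rewrite (_ : partial i _ = fun x => partial i f x + partial i g x); first exact: IH.
by apply/funext => x; rewrite /partial deriveD.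
Qed.

Lemma CkM k f g : Ck k f -> Ck k g -> Ck k (fun x => f x * g x).
Proof.
elim: k f g => [|k IH] f g; first by move=> [cf _] [cg _]; split => // x;
  exact: (cvgM (cf x) (cg x)).
move=> Cf Cg; have [[cf df] [cg dg]] := (Cf, Cg); split => //.
  by move=> x; exact: (cvgM (cf x) (cg x)).
move=> i; have [dfi Cfi] := df i; have [dgi Cgi] := dg i; split.
  by move=> x; apply: derivableM.
rewrite (_ : partial i _ =
    fun x => f x * partial i g x + g x * partial i f x).
  by apply: CkD; apply: IH => //; exact: CkS.
by apply/funext => x; rewrite /partial deriveM.
Qed.

Lemma Ck_prod k (I : Type) (r : seq I) (F : I -> 'cV[R]_n -> R) :
  (forall i, Ck k (F i)) -> Ck k (fun x => \prod_(i <- r) F i x).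
Proof.
move=> CF; elim: r => [|i r IH].
  by under eq_fun do rewrite big_nil; exact: Ck_cst.
by under eq_fun do rewrite big_cons; exact: CkM.
Qed.

(** Restriction to a line turns directional derivatives into derivatives in one variable, to which
    the chain rule [is_derive1_comp] applies. *)
Lemma is_derive_line f (d : R) (x v : 'cV[R]_n) :
  is_derive (0 : R) (1 : R) (fun h => f (h *: v + x)) d <-> is_derive x v f d.
Proof.
have lineE : 'D_1 (fun h : R => f (h *: v + x)) 0 = 'D_v f x.
  rewrite /derive; set g1 := fun h => h^-1 *: _; set g2 := fun h => h^-1 *: _.
  suff -> : g1 = g2 by [].
  apply/funext => h.
  by rewrite /g1 /g2 /= scale0r add0r addr0 /GRing.scale/= mulr1.
split=> -[dfx <-]; apply: DeriveDef => //.
  exact: (proj2 (derivable1P _ _ _) dfx).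
exact: (proj1 (derivable1P _ _ _) dfx).
Qed.

Lemma is_derive_affine (a c x : R) : is_derive x 1 (fun h => a * h + c) a.
Proof.
have dM := is_deriveM (is_derive_cst a x (1 : R)) (is_derive_id x (1 : R)).
have dD := is_deriveD dM (is_derive_cst c x (1 : R)).
by apply: (is_derive_eq dD); rewrite /GRing.scale/= mulr1 mulr0 !addr0.
Qed.

Lemma is_derive_affine_coord (G : R -> R) (a c d : R) (j : 'I_n)
    (x v : 'cV[R]_n) : is_derive (a * x j 0 + c) 1 G d ->
  is_derive x v (fun y => G (a * y j 0 + c)) (d * (a * v j 0)).
Proof.
move=> dG; apply/is_derive_line.
rewrite (_ : (fun h => _) =
    G \o (fun h : R => (a * v j 0) * h + (a * x j 0 + c))).
  apply: is_derive1_comp; last exact: is_derive_affine.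
  by rewrite mulr0 add0r.
by apply/funext => h; rewrite /= !mxE; congr G; ring.
Qed.

(** The induction on k treats all N at once, because the derivative of [flat N] combines [flat N.+1]
    and [flat N.+2]. *)
Lemma Ck_flat k N (a c : R) (j : 'I_n) :
  Ck k (fun x : 'cV[R]_n => flat N (a * x j 0 + c)).
Proof.
elim: k N => [|k IH] N.
  split => // x.
  have cL : {for x, continuous (fun x : 'cV[R]_n => a * x j 0 + c)}.
    have h : (fun y : 'cV[R]_n => y j 0) @ x --> x j 0 by exact: coord_continuous.
    exact: (cvgD (cvgM (cvg_cst a) h) (cvg_cst c)).
  apply: (continuous_comp cL); have [df _] := is_derive_flat N (a * x j 0 + c).
  exact/differentiable_continuous/derivable1_diffP.
split; first exact: Ck_continuous (IH N).
move=> i.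
have d x := @is_derive_affine_coord _ a c _ j x (delta_mx i 0) (is_derive_flat N _).
split=> [x|]; first by have [] := d x.
rewrite (_ : partial i _ = fun x : 'cV[R]_n =>
    (- N%:R * flat N.+1 (a * x j 0 + c) + flat N.+2 (a * x j 0 + c)) *
    (a * (delta_mx i 0 : 'cV[R]_n) j 0)); last first.
  by apply/funext => x; have [_ e] := d x; exact: e.
by apply: CkM; [apply: CkD; [apply: CkM; [exact: Ck_cst|]|]|exact: Ck_cst].
Qed.

End Ck_closure.

Section sup_norm.
Context {R : realType} {m n : nat}.
Implicit Types x : 'M[R]_(m, n).

Lemma le_coord_mx_norm x i j : `|x i j| <= `|x|.
Proof.
by rewrite [leRHS]/Num.Def.normr /= mx_normrE; apply/bigmax_geP; right; exists (i, j).
Qed.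

Lemma mx_norm_trmx_le x : `|x^T| <= `|x|.
Proof.
rewrite [leLHS]/Num.Def.normr /= mx_normrE; apply/bigmax_leP; split => // -[i j] _.
by rewrite mxE; exact: le_coord_mx_norm.
Qed.

End sup_norm.

Section bump.
Context {R : realType} {n : nat}.

Definition box (c : R) : set 'cV[R]_n := [set x | forall i, `|x i 0| <= c].

(** [rV_compact] concerns row vectors, and transposition, which does not increase the sup norm,
    carries compactness over to columns. *)
Lemma compact_box c : compact (box c).
Proof.
have cI := @rV_compact R n (fun=> `[- c, c]%classic) (fun=> @segment_compact R _ _).
rewrite (_ : box c = trmx @` [set v : 'rV[R]_n | forall i, `[- c, c]%classic (v ord0 i)]).
  apply: (continuous_compact _ cI).
  apply: continuous_subspaceT => x A /nbhs_ballP[e /= e0 eA].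
  apply/nbhs_ballP; exists e => //= y xy; apply: eA.
  move: xy; rewrite -!ball_normE /=; apply: le_lt_trans.
  rewrite (_ : x^T - y^T = (x - y)^T); last by rewrite linearB.
  exact: mx_norm_trmx_le.
apply/seteqP; split => [x xc|_ [v vc <-] i]; last first.
  by rewrite mxE ler_norml; have := vc i; rewrite /= in_itv.
exists x^T; last by rewrite trmxK.
by move=> i; rewrite /= mxE in_itv/= -ler_norml; exact: xc.
Qed.

Lemma compact_sub_box (K : set 'cV[R]_n) : compact K ->
  exists2 c : R, 0 < c & K `<=` box c.
Proof.
move=> /compact_bounded [M [_ hM]].
exists (`|M| + 1); first by rewrite ltr_wpDl.
move=> x Kx i; have := hM (`|M| + 1).
rewrite (le_lt_trans (ler_norm _)) ?ltrDl// => /(_ isT x Kx); apply: le_trans.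
exact: le_coord_mx_norm.
Qed.

(** If K lies in the box of half-edge c, the i-th factor vanishes for |x_i| >= c + 1. On K both
    arguments of [flat 0] are at least 1, so each value is at least exp(-1), and the constant exp 2
    makes up for the two. *)
Lemma exists_bump (K : set 'cV[R]_n) : compact K ->
  exists2 f : 'cV[R]_n -> R, Cc_infty f & forall x, K x -> 1 <= f x.
Proof.
move=> /compact_sub_box[c c0 Kc].
pose F (i : 'I_n) (x : 'cV[R]_n) := expR 2 *
  (flat 0 (1 * x i 0 + (c + 1)) * flat 0 (- 1 * x i 0 + (c + 1))).
exists (fun x => \prod_i F i x).
  split=> [k|].
    apply: Ck_prod => i; apply: CkM; first exact: Ck_cst.
    by apply: CkM; exact: Ck_flat.
  apply: (subclosed_compact _ (compact_box (c + 1))); first exact: closed_closure.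
  rewrite [X in _ `<=` X]((closure_id _).1 (compact_closed _ (compact_box (c + 1))))//.
  apply: closure_subset => x /= /prodf_neq0 Fx i.
  have := Fx i isT; rewrite /F mulf_eq0 negb_or => /andP[_].
  rewrite mulf_eq0 negb_or => /andP[h1 h2].
  rewrite ler_norml; apply/andP; split; rewrite leNgt; apply/negP => h.
    by move: h1; rewrite flat_le0 ?eqxx//; lra.
  by move: h2; rewrite flat_le0 ?eqxx//; lra.
move=> x /Kc xc; elim/big_rec : _ => // i y _ y1.
rewrite -[leLHS]mulr1; apply: ler_pM => //.
have := xc i; rewrite ler_norml => /andP[h1 h2].
rewrite /F -[leLHS](expRxMexpNx_1 2) ler_pM2l ?expR_gt0//.
have -> : expR (- 2) = expR (- 1) * expR (- 1) :> R by rewrite -expRD; congr expR; ring.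
by apply: ler_pM; rewrite ?expR_ge0//; apply: flat_ge1; lra.
Qed.

End bump.

(** * Dilations *)

Section support.
Context {R : realType} {m : nat}.
Implicit Types (Q : set 'rV[R]_m) (x y : 'rV[R]_m).

Lemma has_sup_scale (a : R) (A : set R) : 0 < a ->
  has_sup A -> has_sup [set a * z | z in A].
Proof.
move=> a0 [[z Az] [M AM]]; split; first by exists (a * z), z.
by exists (a * M) => _ [t At <-]; rewrite ler_pM2l// AM.
Qed.

Lemma sup_scale (a : R) (A : set R) : 0 < a ->
  sup [set a * z | z in A] = a * sup A.
Proof.
move=> a0; have aK (B : set R) : [set a^-1 * z | z in [set a * z | z in B]] = B.
  rewrite image_comp; apply/seteqP; split => [_ [z Bz <-]/=|z Bz].
    by rewrite mulKf ?gt_eqF.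
  by exists z => //=; rewrite mulKf ?gt_eqF.
(* A set without a supremum has [sup] equal to 0 by default, and scaling preserves this property in
   both directions. *)
have [sA|sA] := pselect (has_sup A); last first.
  rewrite !sup_out ?mulr0// => h; apply: sA; rewrite -(aK A).
  by apply: has_sup_scale => //; rewrite invr_gt0.
have sup_le (c : R) (B : set R) : 0 < c -> has_sup B ->
    sup [set c * z | z in B] <= c * sup B.
  move=> c0 sB; apply: ge_sup; first by have [] := has_sup_scale _ _ c0 sB.
  move=> _ [z Bz <-]; rewrite ler_pM2l//; apply: sup_upper_bound => //.
apply/eqP; rewrite eq_le sup_le//= -ler_pdivlMl// -[in leLHS](aK A).
by apply: sup_le; [rewrite invr_gt0|exact: has_sup_scale].
Qed.

Lemma support_function_scale Q (b a : R) x : 0 < b -> 0 < a ->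
  support_function [set b *: y | y in Q] (a *: x) =
  b * a * support_function Q x.
Proof.
move=> b0 a0; rewrite /support_function -sup_scale ?mulr_gt0//; congr sup.
rewrite !image_comp; apply: eq_imagel => y _ /=.
by rewrite mxdotZl mxdotZr; ring.
Qed.

(** The origin contributes the value 0; if the values are unbounded, [sup] takes its default value
    0. *)
Lemma support_function_ge0 Q x : Q 0 -> 0 <= support_function Q x.
Proof.
move=> Q0; rewrite /support_function.
have [sA|sA] := pselect (has_sup [set mxdot x y | y in Q]); last by rewrite sup_out.
apply: sup_upper_bound => //; exists 0 => //.
by rewrite /mxdot mulmx0 mxtrace0.
Qed.

Lemma support_function_le Q (M A : R) x : Q 0 ->
  (forall y j, Q y -> `|y 0 j| <= M) -> (forall j, `|x 0 j| <= A) ->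
  support_function Q x <= m%:R * (A * M).
Proof.
move=> Q0 QM xA; apply: ge_sup; first by exists (mxdot x 0), 0.
move=> _ [y Qy <-]; rewrite mxdotE big_ord1.
apply: (@le_trans _ _ (\sum_(j < m) A * M)); last first.
  by rewrite sumr_const card_ord mulr_natl.
apply: ler_sum => j _; apply: le_trans (ler_norm _) _; rewrite normrM.
by apply: ler_pM => //; exact: QM.
Qed.

End support.

Section dilation.
Context {R : realType} {n : nat}.
Implicit Types (f : 'cV[R]_n -> R) (x v : 'cV[R]_n).

Lemma is_derive_dilation f (a d : R) x v : is_derive (a *: x) v f d ->
  is_derive x v (fun y => f (a *: y)) (d * a).
Proof.
move=> /is_derive_line df; apply/is_derive_line.
rewrite (_ : (fun h => _) =
    (fun h => f (h *: v + a *: x)) \o (fun h : R => a * h + 0)).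
  by apply: is_derive1_comp; [rewrite mulr0 addr0|exact: is_derive_affine].
by apply/funext => h; rewrite /= addr0 scalerDr scalerA.
Qed.

Lemma partial_dilation f (a : R) i x : (forall x, derivable f x (delta_mx i 0)) ->
  partial i (fun y => f (a *: y)) x = partial i f (a *: x) * a.
Proof.
by move=> df; have [_ e] := is_derive_dilation _ _ _ _ _ (derivableP (df (a *: x))).
Qed.

Lemma Ck_dilation k f (a : R) : Ck k f -> Ck k (fun y => f (a *: y)).
Proof.
have ca : continuous (fun y : 'cV[R]_n => a *: y).
  exact: scaler_continuous.
elim: k f => [|k IH] f.
  by move=> [cf _]; split => // x; exact: (continuous_comp (ca x) (cf _)).
move=> [cf df]; split; first by move=> x; exact: (continuous_comp (ca x) (cf _)).
move=> i; have [dfi Cfi] := df i; split.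
  by move=> x; have [] := is_derive_dilation _ _ _ _ _ (derivableP (dfi (a *: x))).
rewrite (_ : partial i _ = fun x => partial i f (a *: x) * a).
  by apply: CkM; [exact: IH|exact: Ck_cst].
by apply/funext => x; exact: partial_dilation.
Qed.

Lemma Cc_infty_dilation f (a : R) : 0 < a -> Cc_infty f -> Cc_infty (fun y => f (a *: y)).
Proof.
move=> a0 [Cf cf]; split; first by move=> k; exact: Ck_dilation.
pose S := [set a^-1 *: x | x in closure [set x | f x != 0]].
have cS : compact S.
  apply: continuous_compact => //; apply: continuous_subspaceT.
  exact: scaler_continuous.
apply: (subclosed_compact _ cS); first exact: closed_closure.
rewrite [X in _ `<=` X]((closure_id _).1 (compact_closed _ cS))//.
apply: closure_subset => x /= fax; exists (a *: x); first exact: subset_closure.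
by rewrite scalerA mulVf ?gt_eqF// scale1r.
Qed.

End dilation.

(** * Scaling of the energy and of the capacity *)

Section poweRneg.
Context {R : realType}.
Implicit Types (x y : \bar R) (a k : R).
Local Open Scope ereal_scope.

Lemma poweRneg_ge0 x a : 0 <= poweRneg x a.
Proof. by rewrite /poweRneg inve_ge0 poweR_ge0. Qed.

Lemma poweRnegZ x a k : (0 < k)%R -> 0 <= x ->
  poweRneg (k%:E * x) a = ((k `^ a)^-1)%:E * poweRneg x a.
Proof.
move=> k0 x0; rewrite /poweRneg poweRM//; last by rewrite lee_fin ltW.
rewrite poweR_EFin; have ka0 : (0 < k `^ a)%R by rewrite powR_gt0.
have : 0 <= x `^ a by exact: poweR_ge0.
(* Both sides are +oo when the power is 0, and both are 0 when it is +oo. *)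
case: (x `^ a) => [y| |]// y0.
  have [->|yn0] := eqVneq y 0%R.
    by rewrite mule0 inve0 gt0_muley// lte_fin invr_gt0.
  by rewrite -EFinM !inver mulf_eq0 (negbTE yn0) gt_eqF//= invfM EFinM.
by rewrite gt0_muley// invey mule0.
Qed.

Lemma le_poweRneg x y a : (0 <= a)%R -> 0 <= x -> x <= y ->
  poweRneg y a <= poweRneg x a.
Proof.
move=> a0 x0 xy; rewrite /poweRneg lee_pV2 ?inE ?poweR_ge0//.
by apply: gt0_ler_poweR; rewrite // in_itv/= leey andbT// (le_trans x0 xy).
Qed.

End poweRneg.

(** The factor c^(1/p) of the norms becomes c^(-r/p) in front of the integral, and the outer
    exponent -p/r turns it into c. *)
Lemma poweRneg_integral_scale d (T : measurableType d) (R : realType)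
    (mu : {measure set T -> \bar R}) (D : set T) (N N' : T -> \bar R) (p r c : R) :
  0 < r -> 0 < p -> 0 < c -> (forall u, 0 <= N u)%E ->
  (forall u, N' u = (c `^ p^-1)%:E * N u)%E ->
  (poweRneg (\int[mu]_(u in D) poweRneg (N' u) r) (p / r) =
   c%:E * poweRneg (\int[mu]_(u in D) poweRneg (N u) r) (p / r))%E.
Proof.
move=> r0 p0 c0 N0 h.
have k0 : 0 < c `^ p^-1 by rewrite powR_gt0.
under eq_integral do rewrite h poweRnegZ//.
rewrite ge0_integralZl_any; last 2 first.
- by rewrite invr_gt0 powR_gt0.
- by move=> u _; exact: poweRneg_ge0.
rewrite poweRnegZ; last 2 first.
- by rewrite invr_gt0 powR_gt0.
- by apply: integral_ge0 => u _; exact: poweRneg_ge0.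
congr (_%:E * _)%E.
rewrite -!powRN -!powRrM.
rewrite (_ : _ * _ = 1) ?powRr1 ?ltW//.
by field; rewrite !gt_eqF.
Qed.

Section energy.
Context {R : realType} {n m : nat}.
Implicit Types (f g : 'cV[R]_n -> R) (Q : set 'rV[R]_m) (p c : R).

Lemma pnorm_support_ge0 p Q (u : 'M[R]_(n, m)) f : (0 <= pnorm_support p Q u f)%E.
Proof. exact: poweR_ge0. Qed.

Lemma capacity_energy_scale p Q Q' f g c : (0 < n * m)%N -> 0 < p -> 0 < c ->
  (forall u : 'M[R]_(n, m),
    pnorm_support p Q' u g = ((c `^ p^-1)%:E * pnorm_support p Q u f)%E) ->
  capacity_energy p Q' g = (c%:E * capacity_energy p Q f)%E.
Proof.
move=> nm0 p0 c0 h.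
apply: (@poweRneg_integral_scale _ _ R (hausdorff_measure n m (n * m).-1)
  mxsphere (fun u => pnorm_support p Q u f) (fun u => pnorm_support p Q' u g)) => //.
- by rewrite ltr0n.
- by move=> u; exact: pnorm_support_ge0.
Qed.

(** The gradient of f(x/a) is 1/a times that of f at x/a, so the p-th power of the support function
    gains b^p a^-p. The change of variables contributes a^n. *)
Lemma pnorm_support_dilation p Q (a b : R) (u : 'M[R]_(n, m)) f :
  0 < p -> Q 0 -> 0 < a -> 0 < b -> (forall i x, derivable f x (delta_mx i 0)) ->
  pnorm_support p [set b *: y | y in Q] u (fun x => f (a^-1 *: x)) =
  (((b `^ p * a `^ (n%:R - p)) `^ p^-1)%:E * pnorm_support p Q u f)%E.
Proof.
move=> p0 Q0 a0 b0 df; rewrite /pnorm_support.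
pose G t : \bar R := (support_function Q
  (mxgradient u f (\col_i (tnth t i : R))) `^ p)%:E.
have grad x : mxgradient u (fun y => f (a^-1 *: y)) x =
    a^-1 *: mxgradient u f (a^-1 *: x).
  rewrite /mxgradient scalemxAl -linearZ/=; congr (trmx _ *m _).
  by apply/colP => i; rewrite !mxE partial_dilation// mulrC.
have E t : ((support_function [set b *: y | y in Q] (mxgradient u
    (fun y => f (a^-1 *: y)) (\col_i (tnth t i : R)))) `^ p)%:E =
    (((b * a^-1) `^ p)%:E * G (scale_tuple a^-1 n t))%E.
  rewrite grad support_function_scale ?invr_gt0//.
  have ba0 : 0 <= b * a^-1 by rewrite ltW// mulr_gt0// invr_gt0.
  rewrite (powRM _ ba0 (support_function_ge0 _ _ Q0)).
  rewrite EFinM (_ : a^-1 *: _ = \col_i (tnth (scale_tuple a^-1 n t) i : R))//.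
  by apply/colP => i; rewrite !mxE tnth_map.
apply: (@etrans _ _ ((\int[lebesgue_tuple R n]_t
    (((b * a^-1) `^ p)%:E * G (scale_tuple a^-1 n t))) `^ p^-1)%E).
  by congr (_ `^ _)%E; apply: eq_integral => t _; exact: E.
rewrite ge0_integralZl_any//; last 2 first.
- by rewrite powR_gt0// mulr_gt0// invr_gt0.
- by move=> t _; rewrite lee_fin powR_ge0.
have I : (\int[lebesgue_tuple R n]_t G (scale_tuple a^-1 n t) =
    (a ^+ n)%:E * \int[lebesgue_tuple R n]_t G t)%E.
  apply: (@ge0_integral_comp _ _ _ _ R _ _ _ (scale_tuple a n)).
  - exact: measurable_scale_tuple.
  - exact: measurable_scale_tuple.
  - by move=> t; apply: eq_from_tnth => i; rewrite !tnth_map mulKf ?gt_eqF.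
  - by move=> t; apply: eq_from_tnth => i; rewrite !tnth_map mulVKf ?gt_eqF.
  - by rewrite exprn_gt0.
  - move=> A mA; have := @lebesgue_tuple_scale R a^-1 n A.
    by rewrite exprVn invrK invr_gt0; exact.
  - by move=> t; rewrite lee_fin powR_ge0.
apply: (@etrans _ _ ((((b * a^-1) `^ p)%:E *
    ((a ^+ n)%:E * \int[lebesgue_tuple R n]_t G t)) `^ p^-1)%E).
  by congr ((_ * _) `^ _)%E; exact: I.
suff H (J : \bar R) : (0 <= J)%E ->
    ((((b * a^-1) `^ p)%:E * ((a ^+ n)%:E * J)) `^ p^-1 =
     ((b `^ p * a `^ (n%:R - p)) `^ p^-1)%:E * J `^ p^-1)%E.
  by apply: H; apply: integral_ge0 => t _; rewrite lee_fin powR_ge0.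
move=> J0.
rewrite muleA -EFinM poweRM; last 2 first.
- by rewrite lee_fin mulr_ge0 ?powR_ge0 ?exprn_ge0// ltW.
- by [].
rewrite poweR_EFin; congr ((_ `^ _)%:E * _)%E.
rewrite powRM ?invr_ge0 ?(ltW b0) ?(ltW a0)// -mulrA; congr (_ * _).
rewrite -powR_inv1 ?ltW// -powRrM mulN1r -powR_mulrn ?ltW// -powRD; last first.
  by rewrite (gt_eqF a0) implybT.
by rewrite addrC.
Qed.

Lemma capacity_dilation_le p Q (a b : R) (K : set 'cV[R]_n) : (0 < n * m)%N ->
  0 < p -> Q 0 -> 0 < a -> 0 < b ->
  (capacity p [set (b *: y : 'rV[R]_m) | y in Q] [set a *: x | x in K] <=
   (b `^ p * a `^ (n%:R - p))%:E * capacity p Q K)%E.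
Proof.
move=> nm0 p0 Q0 a0 b0; set c := b `^ p * _.
have c0 : 0 < c by rewrite mulr_gt0// powR_gt0.
rewrite -lee_pdivrMl//; apply: le_ereal_inf_tmp => _ [f [Cf fK] <-].
rewrite lee_pdivrMl//; apply: ereal_inf_lbound.
exists (fun x => f (a^-1 *: x)).
  split; first by apply: Cc_infty_dilation => //; rewrite invr_gt0.
  by move=> _ [x Kx <-]; rewrite scalerA mulVf ?gt_eqF// scale1r fK.
apply: capacity_energy_scale => // u; apply: pnorm_support_dilation => //.
by move=> i x; have [_ /(_ i)[]] := Cf.1 1%N.
Qed.

(** The converse inequality is [capacity_dilation_le] for the dilated sets and the factors [a^-1]
    and [b^-1]. *)
Lemma capacity_dilation p Q (a b : R) (K : set 'cV[R]_n) : (0 < n * m)%N ->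
  0 < p -> Q 0 -> 0 < a -> 0 < b ->
  (capacity p [set (b *: y : 'rV[R]_m) | y in Q] [set a *: x | x in K] =
   (b `^ p * a `^ (n%:R - p))%:E * capacity p Q K)%E.
Proof.
move=> nm0 p0 Q0 a0 b0; apply/eqP; rewrite eq_le capacity_dilation_le//=.
have scaleK (V : lmodType R) (k : R) (A : set V) : 0 < k ->
    [set k^-1 *: x | x in [set k *: x | x in A]] = A.
  move=> k0; rewrite image_comp; apply/seteqP; split => [_ [z Bz <-]/=|z Bz].
    by rewrite scalerA mulVf ?gt_eqF// scale1r.
  by exists z => //=; rewrite scalerA mulVf ?gt_eqF// scale1r.
have c0 : 0 < b `^ p * a `^ (n%:R - p) by rewrite mulr_gt0// powR_gt0.
rewrite -lee_pdivlMl//.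
have := @capacity_dilation_le p [set b *: y | y in Q] a^-1 b^-1 [set a *: x | x in K].
rewrite !scaleK// => /(_ nm0 p0) h; apply: le_trans (h _ _ _) _.
- by exists 0 => //; rewrite scaler0.
- by rewrite invr_gt0.
- by rewrite invr_gt0.
have powRV (x r : R) : 0 < x -> x^-1 `^ r = (x `^ r)^-1.
  by move=> x0; rewrite -powR_inv1 ?ltW// -powRrM mulN1r powRN.
by rewrite !powRV// -invfM.
Qed.

End energy.

(** * Finiteness *)

Section finite_energy.
Context {R : realType} {n m : nat}.
Implicit Types (f : 'cV[R]_n -> R) (Q : set 'rV[R]_m) (p : R).

Lemma partial_outside_support f i x :
  ~ closure [set x | f x != 0] x -> partial i f x = 0.
Proof.
move=> Sx; rewrite /partial -[RHS](derive_cst 0 x (delta_mx i 0)).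
apply: near_eq_derive; have := open_nbhs_nbhs (conj (closed_openC (@closed_closure _ _)) Sx).
apply: filterS => y; apply: contra_notP => /eqP fy0.
exact: subset_closure.
Qed.

Lemma partial_bounded f : Cc_infty f ->
  exists2 G : R, 0 <= G & forall i x, `|partial i f x| <= G.
Proof.
move=> [Cf cf].
have bound i : exists G, forall x, `|partial i f x| <= G.
  have cont : continuous (partial i f).
    by have [_ /(_ i)[_ []]] := Cf 1%N.
  have /compact_bounded [M [_ hM]] :=
    continuous_compact (continuous_subspaceT cont) cf.
  exists (`|M| + 1) => x.
  have [Sx|Sx] := pselect (closure [set x | f x != 0] x).
    by apply: hM; [rewrite (le_lt_trans (ler_norm _)) ?ltrDl|exists x].
  by rewrite partial_outside_support ?normr0 ?addr_ge0.
have [G hG] := choice bound.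
(* The sum of the absolute values dominates the bounds of all the partial derivatives at once. *)
exists (\sum_i `|G i|) => [|i x]; first by rewrite sumr_ge0.
apply: le_trans (hG i x) _; rewrite (bigD1 i)//=.
by rewrite (le_trans (ler_norm _))// lerDl sumr_ge0.
Qed.

(** The entries of a unit matrix u are at most 1 in absolute value. The integrand is therefore at
    most a constant independent of u on a cube that contains the support of f, and it vanishes
    outside. *)
Lemma pnorm_support_bounded p Q f : 0 < p -> compact Q -> Q 0 -> Cc_infty f ->
  exists2 M : R, 0 < M & forall u : 'M[R]_(n, m), mxsphere u ->
    (pnorm_support p Q u f <= M%:E)%E.
Proof.
move=> p0 cQ Q0 Cf; have [G G0 hG] := partial_bounded f Cf.
have [c c0 Sc] := compact_sub_box _ Cf.2.
have [MQ [_ hMQ]] := compact_bounded cQ.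
have QM (y : 'rV[R]_m) j : Q y -> `|y 0 j| <= `|MQ| + 1.
  move=> Qy; apply: le_trans (le_coord_mx_norm _ _ _) _.
  by apply: hMQ => //; rewrite (le_lt_trans (ler_norm _)) ?ltrDl.
(* An entry of the gradient matrix is a sum of n terms bounded by [G], and the support function is a
   sum of m products of such entries with entries of Q. The final 1 makes the bound positive. *)
pose B : R := m%:R * (n%:R * G * (`|MQ| + 1)) + 1.
have B0 : 0 < B.
  by rewrite ltr_wpDl// !mulr_ge0 ?addr_ge0.
pose C := cube n (fun=> - c) (2 * c).
have hB (u : 'M[R]_(n, m)) (t : n.-tuple (measurableTypeR R)) : mxsphere u ->
    (((support_function Q (mxgradient u f (\col_i (tnth t i : R)))) `^ p)%:E <=
    (B `^ p)%:E * (\1_C t)%:E)%E.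
  move=> us; set x : 'cV[R]_n := \col_i _.
  have ge0 := support_function_ge0 Q (mxgradient u f x) Q0.
  have [Ct|Ct] := boolP (t \in C).
    rewrite indicE Ct mule1 lee_fin ge0_ler_powR ?nnegrE ?(ltW p0) ?(ltW B0)//.
    apply: le_trans (_ : m%:R * (n%:R * G * (`|MQ| + 1)) <= B); last by rewrite lerDl.
    apply: support_function_le => // j.
    rewrite !mxE; apply: le_trans (ler_norm_sum _ _ _) _.
    apply: (@le_trans _ _ (\sum_(i < n) G)); last first.
      by rewrite sumr_const card_ord mulr_natl.
    apply: ler_sum => i _; rewrite !mxE normrM -[leRHS]mulr1 ler_pM//.
    by rewrite -us le_coord_mxnorm2.
  rewrite indicE (negbTE Ct) mule0 lee_fin.
  have Sx : ~ closure [set x | f x != 0] x.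
    move=> /Sc xc; move/negP: Ct; apply; rewrite inE => i.
    have := xc i; rewrite mxE ler_norml => /andP[h1 h2].
    by apply/andP; split => //; lra.
  suff -> : support_function Q (mxgradient u f x) = 0 by rewrite powR0// gt_eqF.
  apply/eqP; rewrite eq_le ge0 andbT.
  apply: le_trans (support_function_le Q (`|MQ| + 1) 0 _ Q0 QM _) _.
    move=> j; rewrite mxE big1 ?normr0// => i _.
    by rewrite !mxE partial_outside_support ?mul0r.
  by rewrite mul0r mulr0.
pose V : R := B `^ p * (2 * c) ^+ n.
have V0 : 0 < V by rewrite mulr_gt0 ?powR_gt0// exprn_gt0// mulr_gt0.
exists (V `^ p^-1); first by rewrite powR_gt0.
move=> u us; rewrite /pnorm_support -poweR_EFin.
apply: gt0_ler_poweR; rewrite ?invr_ge0 ?(ltW p0)//.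
- by rewrite in_itv/= leey andbT integral_ge0// => t _; rewrite lee_fin powR_ge0.
- by rewrite in_itv/= leey andbT lee_fin ltW.
apply: (@le_trans _ _ (\int[lebesgue_tuple R n]_t ((B `^ p)%:E * (\1_C t)%:E))%E).
  apply: ge0_le_integral_any => t _; first by rewrite lee_fin powR_ge0.
  exact: hB.
rewrite ge0_integralZl_any; last 2 first.
- by rewrite powR_gt0.
- by move=> t _; rewrite lee_fin.
rewrite integral_indic//; last exact: measurable_cube.
rewrite setIT EFinM lee_pmul2l//; last by rewrite lte_fin powR_gt0.
have cube_le : (lebesgue_tuple R n C <= ((2 * c) ^+ n)%:E)%E.
  by rewrite [leLHS]lebesgue_tuple_cube// mulr_ge0// ltW.
exact: cube_le.
Qed.

(** The norms being at most M, the integrand is at least M^(-nm) on a sphere of positive measure.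
    The integral is then positive, and its negative power is not +oo. *)
Lemma capacity_energy_lty p Q f : (0 < n * m)%N -> 0 < p -> compact Q -> Q 0 ->
  Cc_infty f -> (capacity_energy p Q f < +oo)%E.
Proof.
move=> nm0 p0 cQ Q0 Cf.
have [M M0 hM] := pnorm_support_bounded p Q f p0 cQ Q0 Cf.
set r : R := (n * m)%:R.
(* The integral of a constant over the sphere is computed by [integral_cst], which asks for a
   measurable domain. *)
have mS : measurable
    (mxsphere : set (caratheodory_type (@hausdorff_outer R n m (n * m).-1))).
  exact: caratheodory_mxsphere.
pose e := (M `^ r)^-1.
have e0 : 0 < e by rewrite invr_gt0 powR_gt0.
have I_gt0 : (0 < \int[hausdorff_measure n m (n * m).-1]_(u in mxsphere)
    poweRneg (pnorm_support p Q u f) r)%E.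
  apply: (@lt_le_trans _ _
      (\int[hausdorff_measure n m (n * m).-1]_(u in mxsphere) (cst e%:E u))%E).
    rewrite integral_cst//; apply: mule_gt0; first by rewrite lte_fin.
    exact: hausdorff_mxsphere_gt0.
  apply: ge0_le_integral_any => u us; first by rewrite lee_fin ltW.
  have N0 := pnorm_support_ge0 p Q u f.
  apply: le_trans (le_poweRneg _ _ r _ N0 (hM u us)); last exact: ler0n.
  by rewrite /poweRneg poweR_EFin inver gt_eqF ?powR_gt0.
rewrite /capacity_energy ltey -/r /poweRneg inve_eqy.
by rewrite gt_eqF// poweR_gt0.
Qed.

End finite_energy.

Theorem proposition3p2 (R : realType) (n m : nat) (p : R)
    (Q : set 'rV[R]_m) (K : set 'cV[R]_n)
    (n_ge2 : (2 <= n)%N) (m_ge1 : (1 <= m)%N) (p_ge1 : 1 <= p) (p_ltn : p < n%:R)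
    (hQ : convex_body_o Q) (hK : compact K) :
  [/\ forall L : set 'cV[R]_n, compact L -> K `<=` L ->
        (capacity p Q K <= capacity p Q L)%E,
      forall a b : R, 0 < a -> 0 < b ->
        capacity p [set b *: y | y in Q] [set a *: x | x in K] =
        ((b `^ p * a `^ (n%:R - p))%:E * capacity p Q K)%E
    & (capacity p Q K < +oo)%E].
Proof.
have [cQ _ _ Q0] := hQ.
have p0 : 0 < p by exact: lt_le_trans p_ge1.
have nm0 : (0 < n * m)%N by rewrite muln_gt0 (ltnW n_ge2).
split => [L _ KL|a b a0 b0|].
- apply: ereal_inf_le_tmp => _ [f [Cf fL] <-].
  by exists f => //; split => // x /KL; exact: fL.
- exact: capacity_dilation.
- have [f Cf fK] := exists_bump K hK.
  apply: le_lt_trans (capacity_energy_lty p Q f nm0 p0 cQ Q0 Cf).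
  by apply: ereal_inf_lbound; exists f.
Qed.
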